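(* Let $N\in\mathbb{N}$, $m_i\in(0,\infty)$ and $a_i,b_i\in[0,\infty)$ for all $i\in[N]$, and let $X=(X(t))_{t\ge0}$ be the elastic particle system with these parameters started from a deterministic, arbitrary $X(0)\in\mathbb{X}_N$. Let $G(t)=\frac{1}{M_N}\sum_{i\in[N]}m_iX_i(t)$, $t\ge0$, be the centre of mass process. Then $$\mathbb{E}[G(t+h)-G(t)\mid X(t)=x]=-h\,U_N/M_N,\quad\text{for all } t,h\ge0 \text{ and all } x\in\mathbb{X}_N.$$ Moreover, $\lim_{t\to\infty}t^{-1}G(t)=-U_N/M_N$, a.s.
   Context: Notation: $[n]=\{1,2,\dots,n\}$; $\mathbb{X}_N=\{(x_i)_{i\in[N]}\in\mathbb{Z}^N: x_1\le\cdots\le x_N\}$. Elastic particle system: the continuous-time Markov chain $X(t)=(X_i(t))_{i\in[N]}$ on $\mathbb{X}_N$ in which, for each $i\in[N]$, coordinate $X_i(t)$ jumps to $X_i(t)-1$ at rate $A_i(X(t))$ and to $X_i(t)+1$ at rate $B_i(X(t))$, where for $x\in\mathbb{X}_N$ $$A_i(x)=\mathbf{1}\{x_{i-1}<x_i\}\sum_{j=i}^N\frac{m_ja_j}{m_i}\mathbf{1}\{x_j=x_i\},\qquad B_i(x)=\mathbf{1}\{x_{i+1}>x_i\}\sum_{j=1}^i\frac{m_jb_j}{m_i}\mathbf{1}\{x_j=x_i\},$$ with conventions $x_0=-\infty$, $x_{N+1}=+\infty$. Set $u_i=b_i-a_i$, $U_N=-\sum_{i=1}^N m_iu_i$, $M_N=\sum_{i=1}^N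 m_i$. Conditioning on $X(t)=x$ is understood through the (time-homogeneous) Markov transition law started from $x$. *)

(* Defs.v *)
From HB Require Import structures.
From mathcomp Require Import all_boot all_order all_algebra.
From mathcomp Require Import all_classical all_reals all_analysis.
Import Order.TTheory GRing.Theory Num.Theory.
Import numFieldNormedType.Exports.

Set Implicit Arguments.
Unset Strict Implicit.
Unset Printing Implicit Defensive.

Local Open Scope classical_set_scope.
Local Open Scope ring_scope.

(** Time is a real number; only nonnegative times are meaningful, so every
    requirement below is restricted to them. *)

(** [p] is a transition function on [S] whose Q-matrix is [q], that is
    p_h(x,y) = 1{x = y} + q(x,y) h + o(h) as h decreases to 0.  The kernels
    [p t] are probability kernels, so [p] is honest. *)
Record is_transition_function (R : realType) (d : measure_display)
    (S : measurableType d) (q : S -> S -> R) (p : R -> R.-pker S ~> S) : Prop := {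
  transition0 : forall x A, p 0 x A = \d_x A ;
  transition_semigroup : forall s t x A, 0 <= s -> 0 <= t -> measurable A ->
    p (s + t) x A = (\int[p s x]_y p t y A)%E ;
  transition_rates : forall x y,
    (fine (p h x [set y]) - (x == y)%:R) / h @[h --> 0^'+] --> q x y }.

(** [X] is a Markov chain on [S] with transition function [p], started from
    [x0].  The Markov property is the elementary one,
      P(X_s' = z for (s',z) in past, X_s = x, X_{s+h} = y)
        = P(X_s' = z for (s',z) in past, X_s = x) p_h(x,y),
    in product form so that null conditioning events need no separate
    treatment.  Right-continuity is for the discrete topology on [S]. *)
Record is_markov_chain (R : realType) (d d' : measure_display)
    (T : measurableType d) (P : probability T R) (S : measurableType d')
    (p : R -> R.-pker S ~> S) (x0 : S) (X : R -> T -> S) : Prop := {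
  chain_measurable : forall t, 0 <= t -> measurable_fun [set: T] (X t) ;
  chain_start : {ae P, forall w, X 0 w = x0} ;
  chain_right_continuous : {ae P, forall w, forall t, 0 <= t ->
    \forall s \near t^'+, X s w = X t w} ;
  chain_markov : forall (past : seq (R * S)) (s h : R) (x y : S),
    0 <= s -> 0 <= h -> (forall u, u \in past -> 0 <= u.1 <= s) ->
    let history :=
      [set w | (forall u, u \in past -> X u.1 w = u.2) /\ X s w = x] in
    P (history `&` [set w | X (s + h) w = y])
      = (P history * p h x [set y])%E }.

(** E[Z | A] = E[Z 1_A] / P(A); junk when P(A) = 0. *)
Definition cond_expectation (R : realType) (d : measure_display)
    (T : measurableType d) (P : probability T R) (A : set T) (Z : T -> R)
    : \bar R :=
  ((\int[P]_(w in A) (Z w)%:E) * ((fine (P A))^-1)%:E)%E.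

(** The particle labelled i in 1..N is the ordinal i-1 of ['I_N]. *)

Definition ordered_config (N : nat) (x : {ffun 'I_N -> int}) : bool :=
  [forall i : 'I_N, forall j : 'I_N, (i <= j)%N ==> (x i <= x j)].

Definition XN (N : nat) : Type := {x : {ffun 'I_N -> int} | ordered_config x}.

HB.instance Definition _ (N : nat) := SubCountable.on (XN N).

Lemma ordered_config0 (N : nat) : ordered_config [ffun _ : 'I_N => 0%:Z].
Proof.
by apply/forallP => i; apply/forallP => j; apply/implyP; rewrite !ffunE.
Qed.

HB.instance Definition _ (N : nat) :=
  isPointed.Build (XN N) (Sub [ffun _ : 'I_N => 0%:Z] (ordered_config0 N)).

HB.instance Definition _ (N : nat) :=
  @isMeasurable.Build default_measure_display (XN N) discrete_measurable
    discrete_measurable0 discrete_measurableC discrete_measurableU.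

Section Elastic.
Context {R : realType} {N : nat}.
Variables (m a b : 'I_N -> R).

(** The boundary conventions x_0 = -oo and x_{N+1} = +oo are the vacuous cases
    of [free_below] and [free_above]. *)
Definition free_below (x : XN N) (i : 'I_N) : bool :=
  [forall j : 'I_N, (j.+1 == i :> nat) ==> (val x j < val x i)].

Definition free_above (x : XN N) (i : 'I_N) : bool :=
  [forall j : 'I_N, (i.+1 == j :> nat) ==> (val x i < val x j)].

Definition rate_down (i : 'I_N) (x : XN N) : R :=
  (free_below x i)%:R *
  \sum_(j < N | (i <= j)%N) m j * a j / m i * (val x j == val x i)%:R.

Definition rate_up (i : 'I_N) (x : XN N) : R :=
  (free_above x i)%:R *
  \sum_(j < N | (j <= i)%N) m j * b j / m i * (val x j == val x i)%:R.

Definition move_down (i : 'I_N) (x : XN N) : {ffun 'I_N -> int} :=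
  [ffun j => val x j - (j == i)%:Z].

Definition move_up (i : 'I_N) (x : XN N) : {ffun 'I_N -> int} :=
  [ffun j => val x j + (j == i)%:Z].

(** [move_down i x] may leave [XN N], but only if [rate_down i x = 0];
    likewise for [move_up]. *)
Definition elastic_Q (x y : XN N) : R :=
  if x == y then - \sum_(i < N) (rate_down i x + rate_up i x)
  else \sum_(i < N) (rate_down i x * (val y == move_down i x)%:R
                     + rate_up i x * (val y == move_up i x)%:R).

Definition total_mass : R := \sum_(i < N) m i.

Definition U_N : R := - \sum_(i < N) m i * (b i - a i).

Definition centre_of_mass (x : XN N) : R :=
  total_mass^-1 * \sum_(i < N) m i * (val x i)%:~R.

End Elastic.

(* Main.v *)
(** The centre of mass [G] has jumps of size at most 1, bounded total jump rate
    [C], and a generator value [L G] which is constant: within a cluster of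
    coinciding particles only the topmost (lowest) one moves up (down), and it
    carries the momentum [m_j b_j] ([m_j a_j]) of the whole cluster, so that
    [sum_i m_i B_i = sum_j m_j b_j] whatever the configuration.

    Only the pointwise derivative of [p_h(x,y)] at [h = 0] is given.
    Subadditivity of [h |-> 1 - p_h(x,x)] gives [1 - p_h(x,x) <= C h] for all
    [h], hence [h |-> p_h f(x)] is Lipschitz with right derivative [p_h (L f)(x)]
    for bounded [f].  Applied to truncations of [|G - G(x)|], of its square and
    of [G - G(x)], this bounds the moments and shows that the mean grows exactly
    linearly.

    The centred process [M_t] then has second moment [O(t)] uniformly in the
    starting point.  Ottaviani's inequality on dyadic grids, Chebyshev and
    Borel-Cantelli along the times [2^n], and right-continuity of the paths give
    [M_t / t -> 0] almost surely. *)

Require Import Defs.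
From HB Require Import structures.
From mathcomp Require Import all_boot all_order all_algebra.
From mathcomp Require Import all_classical all_reals all_analysis.
From mathcomp Require Import measurable_realfun ring lra.
Import Order.TTheory GRing.Theory Num.Theory.
Import numFieldNormedType.Exports.

Set Implicit Arguments.
Unset Strict Implicit.
Unset Printing Implicit Defensive.

Local Open Scope classical_set_scope.
Local Open Scope ring_scope.

(** * Integration on a discrete space *)

Section DiscreteSpace.
Context {R : realType} {d : measure_display} {S : measurableType d}.
Hypothesis mS : forall A : set S, measurable A.

Lemma measurable_fun_discrete d' (Y : measurableType d') (D : set S)
  (f : S -> Y) : measurable_fun D f.
Proof. by move=> _ B _; exact: mS. Qed.

Context (mu : {measure set S -> \bar R}) (mu1 : mu [set: S] = 1%E).

Lemma integrable_bounded (f : S -> R) (K : R) :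
  (forall y, `|f y| <= K) -> mu.-integrable [set: S] (EFin \o f).
Proof.
move=> fK; apply: measurable_bounded_integrable => //.
- by rewrite mu1 ltry.
- exists K; split; first by rewrite num_real.
  by move=> M KM y _; exact: le_trans (fK y) (ltW KM).
Qed.

Lemma Rintegral_cst_prob (c : R) : \int[mu]_y c = c.
Proof. by rewrite Rintegral_cst// mu1 mulr1. Qed.

Lemma Rintegral_le_cst (f : S -> R) (K c : R) :
  (forall y, `|f y| <= K) -> (forall y, f y <= c) -> \int[mu]_y f y <= c.
Proof.
move=> fK fc; rewrite -[leRHS]Rintegral_cst_prob; apply: le_Rintegral => //.
- exact: integrable_bounded fK.
- exact: (@integrable_bounded _ `|c|).
Qed.

Lemma normr_Rintegral_le_cst (f : S -> R) (K : R) :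
  (forall y, `|f y| <= K) -> `|\int[mu]_y f y| <= K.
Proof.
move=> fK; apply: le_trans (le_normr_Rintegral _ _) _ => //.
  exact: integrable_bounded fK.
by apply: (@Rintegral_le_cst _ K) => // y; rewrite normr_id.
Qed.

Lemma EFin_Rintegral (f : S -> R) : mu.-integrable [set: S] (EFin \o f) ->
  (\int[mu]_y f y)%:E = (\int[mu]_y (f y)%:E)%E.
Proof. by move=> fi; rewrite /Rintegral fineK//; exact: integrable_fin_num. Qed.

Lemma Rintegral_point_sum (s : seq S) (c : S -> R) :
  \int[mu]_z (\sum_(y <- s) (z == y)%:R * c y)
  = \sum_(y <- s) fine (mu [set y]) * c y.
Proof.
have int1 (y : S) (k : R) :
    mu.-integrable [set: S] (EFin \o (fun z => (z == y)%:R * k)).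
  apply: (integrable_bounded (K := `|k|)) => z.
  by case: eqP => _; rewrite ?mul1r// mul0r normr0.
elim: s => [|y s IH].
  under eq_Rintegral do rewrite big_nil.
  by rewrite big_nil Rintegral_cst// mul0r.
under eq_Rintegral do rewrite big_cons.
rewrite RintegralD//; last first.
  apply: (integrable_bounded (K := \sum_(y <- s) `|c y|)) => z /=.
  apply: le_trans (ler_norm_sum _ _ _) _; apply: ler_sum => w _.
  by case: eqP => _; rewrite ?mul1r// mul0r normr0.
rewrite IH big_cons; congr (_ + _).
rewrite RintegralZr//; last first.
  by apply: (integrable_bounded (K := 1)) => z; case: eqP; rewrite ?normr1 ?normr0.
congr (_ * _); rewrite /Rintegral; congr fine.
rewrite -[X in _ = mu X]setIT -integral_indic//; apply: eq_integral => z _.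
by rewrite indicE in_set1.
Qed.

(* Outside [s] the integrand is at most [2 * K], inside [s] it is exact. *)
Lemma normr_Rintegral_sub_point_sum (s : seq S) (x : S) (f : S -> R) (K : R) :
  uniq s -> (forall y, `|f y| <= K) ->
  `|\int[mu]_y f y - f x - \sum_(y <- s) fine (mu [set y]) * (f y - f x)|
    <= 2 * K * (1 - \sum_(y <- s) fine (mu [set y])).
Proof.
move=> us fK.
have sum1 (z : S) (c : S -> R) :
    \sum_(y <- s) (z == y)%:R * c y = (z \in s)%:R * c z.
  have [zs|zs] := boolP (z \in s).
    rewrite (bigD1_seq z)//= eqxx big1 ?addr0// => y.
    by rewrite eq_sym => /negPf ->; rewrite mul0r.
  rewrite mul0r big_seq big1// => y ys.
  by rewrite (_ : z == y = false) ?mul0r//; apply: contraNF zs => /eqP ->.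
(* The left side of the claim is the modulus of the integral of [g], the right side the integral of
   [h], and |g| <= h pointwise. The factor [* 1] gives [h] the shape required by
   [Rintegral_point_sum]. *)
pose g z := f z - f x - \sum_(y <- s) (z == y)%:R * (f y - f x).
pose h z := 2 * K * (1 - \sum_(y <- s) (z == y)%:R * 1).
have K0 : 0 <= K by apply: le_trans (fK x).
have gh z : `|g z| <= h z.
  rewrite /g /h !sum1; case: (z \in s) => /=.
    by rewrite !mul1r !subrr mulr0 normr0.
  rewrite !mul0r !subr0 mulr1; apply: le_trans (ler_normB _ _) _.
  by rewrite mulrDl mul1r lerD.
have hK z : `|h z| <= 2 * K.
  rewrite /h sum1; case: (z \in s) => /=.
    by rewrite mul1r subrr mulr0 normr0 mulr_ge0.
  by rewrite mul0r subr0 mulr1 ger0_norm// mulr_ge0.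
have gK z : `|g z| <= 2 * K.
  by apply: le_trans (gh z) (le_trans (ler_norm _) (hK z)).
have fi := integrable_bounded fK.
have ci (c : R) : mu.-integrable [set: S] (EFin \o cst c).
  exact: (integrable_bounded (K := `|c|)).
have si (c : S -> R) (M : R) : (forall y, `|c y| <= M) ->
    mu.-integrable [set: S]
      (EFin \o (fun z => \sum_(y <- s) (z == y)%:R * c y)).
  move=> cM; apply: (integrable_bounded (K := M)) => z.
  rewrite sum1; case: (z \in s); rewrite ?mul1r//.
  by rewrite mul0r normr0 (le_trans _ (cM z)).
have fxK y : `|f y - f x| <= K + K.
  by apply: le_trans (ler_normB _ _) _; rewrite lerD.
have eg : \int[mu]_y f y - f x - \sum_(y <- s) fine (mu [set y]) * (f y - f x)
    = \int[mu]_z g z.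
  rewrite /g RintegralB//; last 2 first.
  - by apply: integrable_bounded => // y; exact: fxK.
  - exact: si fxK.
  rewrite RintegralB//; last exact: ci.
  by rewrite Rintegral_point_sum (Rintegral_cst_prob).
have eh : 2 * K * (1 - \sum_(y <- s) fine (mu [set y])) = \int[mu]_z h z.
  have s1 := si (cst 1) 1 (fun=> eq_ind_r (fun z => z <= 1) (lexx _) (normr1 _)).
  rewrite /h RintegralZl//; last first.
    apply: (integrable_bounded (K := 1)) => z /=.
    rewrite sum1; case: (z \in s); rewrite ?mul1r ?subrr ?normr0//.
    by rewrite mul0r subr0 normr1.
  rewrite RintegralB//; last exact: ci.
  rewrite Rintegral_point_sum (Rintegral_cst_prob).
  by under [in RHS]eq_bigr do rewrite mulr1.
rewrite eg eh; apply: le_trans (le_normr_Rintegral _ _) _ => //.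
  exact: integrable_bounded gK.
apply: le_Rintegral => //.
- by apply: (integrable_bounded (K := 2 * K)) => z; rewrite normr_id.
- exact: integrable_bounded hK.
Qed.

End DiscreteSpace.

Section MonotoneLimit.
Context {R : realType} {d : measure_display} {S : measurableType d}.
Hypothesis mS : forall A : set S, measurable A.
Context (mu : {measure set S -> \bar R}).

(** Monotone convergence for truncations that become exact at each point: a bound uniform in the
    truncation level passes to the untruncated function. *)
Lemma ge0_integral_le_eventually (F : nat -> S -> R) (f : S -> R) (B : \bar R) :
  (forall n y, 0 <= F n y) -> (forall y, nondecreasing_seq (F ^~ y)) ->
  (forall y, \forall n \near \oo, F n y = f y) ->
  (forall n, \int[mu]_y (F n y)%:E <= B)%E -> (\int[mu]_y (f y)%:E <= B)%E.
Proof.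
move=> F0 Fnd Ff FB.
have cv y : (F n y)%:E @[n --> \oo] --> (f y)%:E.
  by apply: cvg_EFin; [exact: nearW|apply: cvg_near_cst; exact: Ff].
have -> : (\int[mu]_y (f y)%:E = \int[mu]_y limn (fun n => (F n y)%:E))%E.
  by apply: eq_integral => y _; apply/esym/cvg_lim.
rewrite monotone_convergence//.
- apply: lime_le; last exact: nearW.
  apply: ereal_nondecreasing_is_cvgn => m n mn.
  apply: ge0_le_integral => //; rewrite ?measurable_fun_discrete//.
  + by move=> y _; rewrite lee_fin.
  + by move=> y _; rewrite lee_fin Fnd.
- by move=> n; exact: measurable_fun_discrete.
- by move=> n y _; rewrite lee_fin.
- by move=> y _ m n mn; rewrite lee_fin Fnd.
Qed.

End MonotoneLimit.

(** * Truncation of real numbers *)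

Section Clipping.
Context {R : realDomainType}.

Lemma normr_minB_le (K u v : R) : `|Num.min u K - Num.min v K| <= `|u - v|.
Proof.
have := ler_norm (u - v); have := ler_norm (v - u); rewrite (distrC v u).
rewrite ler_norml; set w := `|u - v|.
by case: (lerP u K); case: (lerP v K); lra.
Qed.

Lemma normr_maxB_le (K u v : R) : `|Num.max K u - Num.max K v| <= `|u - v|.
Proof.
have := ler_norm (u - v); have := ler_norm (v - u); rewrite (distrC v u).
rewrite ler_norml; set w := `|u - v|.
by case: (lerP K u); case: (lerP K v); lra.
Qed.

(** For [0 <= K], the projection onto [-K, K]; it preserves the sign, as the computation of a mean
    requires. *)
Definition clip (K u : R) : R := Num.max (- K) (Num.min u K).

Lemma normr_clipB_le K u v : `|clip K u - clip K v| <= `|u - v|.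
Proof. exact: le_trans (normr_maxB_le _ _ _) (normr_minB_le _ _ _). Qed.

Lemma normr_clip_le K u : 0 <= K -> `|clip K u| <= K.
Proof.
move=> K0; rewrite ler_norml /clip le_max lexx/= ge_max ge_min lexx orbT andbT.
lra.
Qed.

Lemma clip_id K u : `|u| <= K -> clip K u = u.
Proof.
rewrite ler_norml => /andP[Ku uK].
by rewrite /clip (min_idPl uK) (max_idPr Ku).
Qed.

Lemma normr_sub_clip_le K u : 0 <= K -> `|u - clip K u| <= `|u|.
Proof.
move=> K0; rewrite ler_norml /clip; have := ler_norm u; have := ler_norm (- u).
rewrite normrN; set w := `|u| => h1 h2.
by case: (lerP u K) => ?; [case: (lerP (- K) u)|case: (lerP (- K) K)] => ?; lra.
Qed.

End Clipping.

(** * A mean value inequality for right difference quotients *)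

Section MeanValue.
Context {R : realType}.

(** Consider the supremum of the times at which the linear bound with slope [c + e] holds. The
    Lipschitz condition makes the bound hold at the supremum, and one small step to the right would
    exceed the supremum if it were below [T]. *)
Lemma right_difference_le (phi : R -> R) (T c M : R) : 0 <= T ->
  (forall s t : R, 0 <= s <= t -> t <= T -> `|phi t - phi s| <= M * (t - s)) ->
  (forall t e eta : R, 0 <= t < T -> 0 < e -> 0 < eta ->
    exists h : R, 0 < h <= eta /\ phi (t + h) - phi t <= (c + e) * h) ->
  phi T <= phi 0 + c * T.
Proof.
move=> T0 lip hd.
have M0 : 0 <= M \/ T = 0.
  move: T0; rewrite le_eqVlt => /predU1P[<-|T0]; [by right|left].
  have := lip 0 T; rewrite !lexx (ltW T0) => /(_ isT isT).
  by rewrite subr0 => /(le_trans (normr_ge0 _)); rewrite pmulr_lge0.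
case: M0 => [M0|->]; last by rewrite mulr0 addr0.
suff key e : 0 < e -> phi T <= phi 0 + (c + e) * T.
  apply/ler_addgt0Pr => e e0.
  (* A slope excess of [e / (T + 1)] costs at most [e] over [0, T]; the [+ 1] keeps the denominator
     positive. *)
  have e'0 : 0 < e / (T + 1) by rewrite divr_gt0// ltr_wpDl.
  apply: le_trans (key _ e'0) _; rewrite mulrDl addrA lerD2l.
  rewrite -mulrA ger_pMr// ler_pdivrMl; last by rewrite ltr_wpDl.
  by rewrite mulr1 lerDl.
move=> e0.
pose A := [set t : R | 0 <= t <= T /\ phi t <= phi 0 + (c + e) * t].
have A0 : A 0 by rewrite /A/= lexx T0 mulr0 addr0.
have ubA : has_ubound A by exists T => t [/andP[]].
have supA : has_sup A by split=> //; exists 0.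
set sg := sup A.
have sg0 : 0 <= sg by apply: ub_le_sup.
have sgT : sg <= T by apply: ge_sup; [exists 0|move=> t [/andP[]]].
have sgA : phi sg <= phi 0 + (c + e) * sg.
  apply/ler_addgt0Pr => z z0.
  (* [k] covers the variation of [phi] and of the linear bound together, so a point of [A] within
     [z / k] of the supremum gives the bound there up to [z]. *)
  pose k := M + `|c + e| + 1.
  have k0 : 0 < k by rewrite /k ltr_wpDl// addr_ge0.
  have [t [/andP[t0 tT] At] tsg] := sup_adherent (divr_gt0 z0 k0) supA.
  have tsg' : t <= sg by apply: ub_le_sup => //; split=> //; rewrite t0 tT.
  have := lip t sg; rewrite t0 tsg' => /(_ isT sgT) /(le_trans (ler_norm _)) l.
  have d1 : 0 <= sg - t by rewrite subr_ge0.
  have d2 : k * (sg - t) <= z.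
    by rewrite mulrC -ler_pdivlMr// lerBlDl -lerBlDr ltW.
  have d3 : (c + e) * t - (c + e) * sg <= `|c + e| * (sg - t).
    rewrite -mulrBr -opprB mulrN -mulNr; apply: ler_wpM2r => //.
    by rewrite -normrN ler_norm.
  move: d2; rewrite /k 2!mulrDl mul1r => d2.
  by move: At l d1 d2 d3; clear; lra.
have [->//|sgNT] := eqVneq T sg.
have sgltT : sg < T by rewrite lt_neqAle eq_sym sgNT.
have Tsg0 : 0 < T - sg by rewrite subr_gt0.
have [|h [/andP[h0 hT] hphi]] := hd sg e _ _ e0 Tsg0; first by rewrite sg0.
have : A (sg + h).
  split; first by apply/andP; split; [rewrite addr_ge0// ltW|rewrite -lerBrDl].
  by move: sgA hphi; clear; lra.
move=> /(ub_le_sup ubA); rewrite -/sg gerDl => /le_lt_trans /(_ h0).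
by rewrite ltxx.
Qed.

End MeanValue.

(** * Transition functions with bounded rates *)

Section Semigroup.
Context {R : realType} {d : measure_display} {S : measurableType d}.
Hypothesis mS : forall A : set S, measurable A.
Context (q : S -> S -> R) (p : R -> R.-pker S ~> S).
Hypothesis hp : is_transition_function q p.

Let p1 t x : p t x [set: S] = 1%E. Proof. exact: prob_kernel. Qed.

Let fin_p t x A : p t x A \is a fin_num.
Proof. by apply: finite_kernel_measure. Qed.

(** The semigroup identity on sets says that [p (s + t) x] is the composed kernel as a measure, so
    the iterated integral formula for compositions applies. *)
Lemma ge0_integral_semigroup (s t : R) x (f : S -> \bar R) :
  0 <= s -> 0 <= t -> (forall y, 0 <= f y)%E ->
  (\int[p (s + t) x]_y f y = \int[p s x]_y \int[p t y]_z f z)%E.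
Proof.
move=> s0 t0 f0.
have mf : measurable_fun [set: S] f by exact: measurable_fun_discrete.
have <- := @integral_kcomp _ _ _ _ _ _ _ (p s) (kernel.kernel_snd (p t)) x f f0 mf.
apply: eq_measure_integral => A mA _ /=.
by rewrite (transition_semigroup hp).
Qed.

Lemma Rintegral_semigroup (s t : R) x (f : S -> R) (K : R) :
  0 <= s -> 0 <= t -> (forall y, `|f y| <= K) ->
  \int[p (s + t) x]_y f y = \int[p s x]_y \int[p t y]_z f z.
Proof.
move=> s0 t0 fK.
have fi u y := integrable_bounded mS (p1 u y) fK.
have gK y : `|\int[p t y]_z f z| <= K.
  exact: (normr_Rintegral_le_cst mS (p1 t y)).
have gi := integrable_bounded mS (p1 s x) gK.
have ci (c : R) u y : (p u y).-integrable [set: S] (EFin \o cst c).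
  exact: (integrable_bounded mS (p1 u y) (K := `|c|)).
have fK0 y : 0 <= f y + K.
  by rewrite -lerBlDr sub0r; have := fK y; rewrite ler_norml => /andP[].
have shift u y : \int[p u y]_z (f z + K) = \int[p u y]_z f z + K.
  by rewrite RintegralD//; [rewrite (Rintegral_cst_prob mS (p1 u y))|exact: ci].
(* Adding [K] makes the integrand nonnegative and changes both sides by the same constant. *)
apply: (addIr K); rewrite -shift.
rewrite -[X in _ = _ + X](Rintegral_cst_prob mS (p1 s x)) -RintegralD//; last first.
  exact: ci.
under [RHS]eq_Rintegral do rewrite -shift.
rewrite /Rintegral ge0_integral_semigroup//.
congr fine; apply: eq_integral => y _; rewrite fineK//.
apply: integrable_fin_num => //.
apply: (integrable_bounded mS (p1 t y) (K := K + K)) => z.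
apply: le_trans (ler_normD _ _) _; rewrite lerD// ger0_norm//.
exact: le_trans (fK z).
Qed.

Lemma Rintegral_transition0 x (f : S -> R) : \int[p 0 x]_y f y = f x.
Proof.
rewrite /Rintegral (eq_measure_integral (dirac x)); last first.
  by move=> A _ _; rewrite /= (transition0 hp).
by rewrite integral_dirac ?diracT ?mul1e.
Qed.

Lemma fine_transition_ge0_le1 t x A : 0 <= fine (p t x A) <= 1.
Proof.
rewrite fine_ge0//= -lee_fin fineK//.
by rewrite -(p1 t x); apply: le_measure; rewrite ?inE//; exact: mS.
Qed.

(** Being at [x] at time [s] and again at [s + t] is one way of being at [x] at time [s + t]. *)
Lemma transition_stay_supermul s t x : 0 <= s -> 0 <= t ->
  fine (p s x [set x]) * fine (p t x [set x]) <= fine (p (s + t) x [set x]).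
Proof.
move=> s0 t0; rewrite -lee_fin EFinM !fineK// (transition_semigroup hp)//.
have -> : (p s x [set x] * p t x [set x]
    = \int[p s x]_(y in [set x]) p t y [set x])%E.
  rewrite muleC -integral_cst//.
  by apply: eq_integral => y; rewrite inE => ->.
by apply: ge0_subset_integral.
Qed.

(** From 1 - uv <= (1 - u) + (1 - v) for u, v in [0, 1]. *)
Lemma transition_leave_subadd s t x : 0 <= s -> 0 <= t ->
  1 - fine (p (s + t) x [set x])
    <= (1 - fine (p s x [set x])) + (1 - fine (p t x [set x])).
Proof.
move=> s0 t0; have := transition_stay_supermul x s0 t0.
have /andP[_] := fine_transition_ge0_le1 s x [set x].
have /andP[_] := fine_transition_ge0_le1 t x [set x].
nra.
Qed.

Lemma transition_leave_mulrn n h x : 0 <= h ->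
  1 - fine (p (h *+ n) x [set x]) <= (1 - fine (p h x [set x])) *+ n.
Proof.
move=> h0; elim: n => [|n IH].
  by rewrite !mulr0n (transition0 hp) diracE mem_set//= subrr.
rewrite !mulrSr; apply: le_trans (transition_leave_subadd _ _ h0) _.
  exact: mulrn_wge0.
by rewrite lerD2r.
Qed.

End Semigroup.

(** * Generator and Dynkin's formula for finitely many kinds of jumps *)

Section JumpProcess.
Context {R : realType} {d : measure_display} {S : measurableType d}.
Hypothesis mS : forall A : set S, measurable A.
Context (q : S -> S -> R) (p : R -> R.-pker S ~> S).
Hypothesis hp : is_transition_function q p.
Context (I : finType) (r : I -> S -> R) (tau : I -> S -> S) (C : R).
Hypothesis r_ge0 : forall k x, 0 <= r k x.
Hypothesis r_le : forall x, \sum_k r k x <= C.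
Hypothesis qE : forall x y,
  q x y = \sum_k r k x * ((y == tau k x)%:R - (y == x)%:R).

Let p1 t x : p t x [set: S] = 1%E. Proof. exact: prob_kernel. Qed.

Definition generator (f : S -> R) (x : S) : R :=
  \sum_k r k x * (f (tau k x) - f x).

Lemma rate_bound_ge0 (x : S) : 0 <= C.
Proof. by apply: le_trans (r_le x); apply: sumr_ge0. Qed.

Lemma normr_generator_le (f : S -> R) (K : R) x : 0 <= K ->
  (forall k, `|f (tau k x) - f x| <= K) -> `|generator f x| <= K * C.
Proof.
move=> K0 fK; apply: le_trans (ler_norm_sum _ _ _) _.
apply: (@le_trans _ _ (\sum_k r k x * K)).
  by apply: ler_sum => k _; rewrite normrM ger0_norm// ler_wpM2l.
by rewrite -mulr_suml mulrC ler_wpM2l.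
Qed.

(* Subadditivity of [h |-> 1 - p_h(x,x)] turns the limit at 0 into a bound
   valid for all times. *)
Lemma transition_leave_le (h : R) (x : S) : 0 <= h -> 1 - fine (p h x [set x]) <= C * h.
Proof.
rewrite le_eqVlt => /predU1P[<-|h0].
  by rewrite (transition0 hp) diracE mem_set//= subrr mulr0.
have qx : - q x x <= C.
  rewrite qE -sumrN; apply: le_trans (r_le x); apply: ler_sum => k _.
  rewrite eqxx -mulrN opprB; apply: ler_piMr => //.
  by rewrite gerBl ler0n.
suff : - q x x * h >= 1 - fine (p h x [set x]).
  by move/le_trans; apply; rewrite ler_wpM2r// ltW.
(* Cut [h] into [n.+1] equal steps: by subadditivity every difference quotient at [h / n.+1] bounds
   the left side, hence so does its limit. *)
have /cvg_at_rightP cv := @transition_rates _ _ _ _ _ hp x x.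
have hn : h / n.+1%:R @[n --> \oo] --> (0 : R).
  rewrite -(mulr0 h); apply: cvgMr; exact: cvg_harmonic.
have {}cv := cv (fun n => h / n.+1%:R) (conj (fun n => divr_gt0 h0 (ltr0Sn _ _)) hn).
have {cv} : - (fine (p (h / n.+1%:R) x [set x]) - (x == x)%:R) / (h / n.+1%:R) * h
    @[n --> \oo] --> - q x x * h.
  apply: cvgMl; under eq_fun do rewrite mulNr.
  exact: cvgN.
move=> /cvgr_to_ge; apply; apply: nearW => n.
have hn0 : 0 <= h / n.+1%:R by rewrite divr_ge0// ltW.
have := transition_leave_mulrn mS hp n.+1 x hn0.
have -> : h / n.+1%:R *+ n.+1 = h by rewrite -mulr_natr divfK// pnatr_eq0.
rewrite -(mulr_natr (1 - _)) => /le_trans; apply.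
rewrite eqxx opprB le_eqVlt; apply/orP; left; apply/eqP.
rewrite /=; by field; rewrite !gt_eqF.
Qed.


(** The one-point list [[:: x]] leaves a zero point sum and the error 1 - p_h(x,x), which
    [transition_leave_le] bounds. *)
Lemma normr_transition_increment_le (f : S -> R) (K : R) h x :
  0 <= h -> (forall y, `|f y| <= K) ->
  `|\int[p h x]_y f y - f x| <= 2 * K * C * h.
Proof.
move=> h0 fK.
have := normr_Rintegral_sub_point_sum mS (p1 h x) (s := [:: x]) x isT fK.
rewrite !big_seq1 subrr mulr0 subr0 => /le_trans; apply.
rewrite -[leRHS]mulrA ler_wpM2l ?transition_leave_le//.
by rewrite mulr_ge0// (le_trans _ (fK x)).
Qed.

Lemma sum_rates (s : seq S) (g : S -> R) (x : S) :
  uniq s -> x \in s -> (forall k, tau k x \in s) ->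
  \sum_(y <- s) q x y * g y = \sum_k r k x * (g (tau k x) - g x).
Proof.
move=> us xs ts.
have sum1 (z : S) : z \in s -> \sum_(y <- s) (y == z)%:R * g y = g z.
  move=> zs; rewrite (bigD1_seq z)//= eqxx mul1r big1 ?addr0// => y.
  by move=> /negPf ->; rewrite mul0r.
under eq_bigr do rewrite qE mulr_suml.
rewrite exchange_big/=; apply: eq_bigr => k _.
under eq_bigr do rewrite -mulrA mulrBl.
by rewrite -mulr_sumr sumrB !sum1.
Qed.

(** On the finite list [s] of [x] and its targets the rates give the limit termwise; outside [s] the
    boundedness of [f] leaves an error proportional to the escaping mass divided by [h]. *)
Lemma cvg_generator (f : S -> R) (K : R) x : (forall y, `|f y| <= K) ->
  (\int[p h x]_y f y - f x) / h @[h --> 0^'+] --> generator f x.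
Proof.
move=> fK.
pose s := undup (x :: [seq tau k x | k <- enum I]).
have us : uniq s by exact: undup_uniq.
have xs : x \in s by rewrite mem_undup inE eqxx.
have ts k : tau k x \in s.
  by rewrite mem_undup inE map_f ?orbT// mem_enum.
pose F (g : S -> R) (h : R) :=
  \sum_(y <- s) (fine (p h x [set y]) - (x == y)%:R) / h * g y.
have cF g : F g h @[h --> 0^'+] --> \sum_k r k x * (g (tau k x) - g x).
  rewrite -(sum_rates g us xs ts).
  apply: cvg_big => [|y _]; first exact: add_continuous.
  by apply: cvgMl; exact: (@transition_rates _ _ _ _ _ hp).
have sumE (h : R) (g : S -> R) : F g h =
    (\sum_(y <- s) fine (p h x [set y]) * g y - g x) / h.
  rewrite /F; under eq_bigr do rewrite mulrAC mulrBl.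
  rewrite -mulr_suml sumrB; congr ((_ - _) / _).
  rewrite (bigD1_seq x)//= eqxx mul1r big1 ?addr0// => y.
  by rewrite eq_sym => /negPf ->; rewrite mul0r.
(* [- F (cst 1) h] is the mass outside [s] divided by [h]. It tends to 0 because the entries of row
   [x] of [q] over [s] sum to 0. *)
have c1 := cF (cst 1).
rewrite (_ : \sum_k _ = 0) in c1; last first.
  by apply: big1 => k _; rewrite subrr mulr0.
have cf := cF (fun y => f y - f x).
rewrite (_ : \sum_k _ = generator f x) in cf; last first.
  by apply: eq_bigr => k _; rewrite subrr subr0.
apply: (cvg_sub0 _ cf); apply: norm_cvg0.
apply: (@squeeze_cvgr _ _ _ _ (cst 0) (fun h => 2 * K * - F (cst 1) h)).
- near=> h; rewrite normr_ge0/=.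
  have h0 : 0 < h by near: h; exact: nbhs_right_gt.
  have := normr_Rintegral_sub_point_sum mS (p1 h x) x us fK.
  rewrite !fctE !sumE /= subrr subr0 -mulrBl normrM (gtr0_norm (_ : 0 < h^-1)) ?invr_gt0//.
  rewrite -mulr_suml mulr1 -mulNr opprB mulrA => bd.
  by rewrite ler_pM2r ?invr_gt0.
- exact: cvg_cst.
- have : 2 * K * - F (cst 1) h @[h --> 0^'+] --> 2 * K * - 0.
    by apply: cvgMr; apply: cvgN; exact: c1.
  by rewrite oppr0 mulr0.
Unshelve. all: by end_near. Qed.

(* Dynkin's formula as an inequality; the forward equation only enters through
   right derivatives. *)
Lemma dynkin_le (f : S -> R) (K T c : R) (x : S) :
  0 <= T -> (forall y, `|f y| <= K) ->
  (forall s : R, 0 <= s <= T -> \int[p s x]_y generator f y <= c) ->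
  \int[p T x]_y f y <= f x + c * T.
Proof.
move=> T0 fK Lc.
have C0 : 0 <= C := rate_bound_ge0 x.
have K0 : 0 <= K by apply: le_trans (fK x).
have fi u y := integrable_bounded mS (p1 u y) fK.
pose D h y := \int[p h y]_z f z - f y.
have DK (h : R) y : 0 <= h -> `|D h y| <= 2 * K * C * h.
  by move=> h0; exact: normr_transition_increment_le.
have incr (s h : R) : 0 <= s -> 0 <= h ->
    \int[p (s + h) x]_y f y - \int[p s x]_y f y = \int[p s x]_y D h y.
  move=> s0 h0; rewrite (Rintegral_semigroup mS hp _ s0 h0 fK) RintegralB//.
  apply: (integrable_bounded mS (p1 s x) (K := K)) => y.
  exact: normr_Rintegral_le_cst.
rewrite -[f x](Rintegral_transition0 mS hp).
apply: (@right_difference_le _ (fun t => \int[p t x]_y f y) T c (2 * K * C)) => //.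
- move=> s t /andP[s0 st] _; rewrite -[t in p t x](subrKC s) incr ?subr_ge0//.
  apply: normr_Rintegral_le_cst => // y.
  by apply: DK; rewrite subr_ge0.
move=> t e eta /andP[t0 tT] e0 eta0.
pose h n := eta / n.+1%:R.
have h0 n : 0 < h n by rewrite divr_gt0.
have hcv : h n @[n --> \oo] --> (0 : R).
  by rewrite -(mulr0 eta); apply: cvgMr; exact: cvg_harmonic.
have genK y : `|generator f y| <= (K + K) * C.
  apply: normr_generator_le; first exact: addr_ge0.
  by move=> k; apply: le_trans (ler_normB _ _) _; rewrite lerD.
(* The quotients are bounded by [2 * K * C] uniformly in [y], so dominated convergence takes the
   limit under [p t x] and yields the right derivative at [t] along the steps [h n]. *)
have dct : \int[p t x]_y (D (h n) y / h n) @[n --> \oo]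
    --> \int[p t x]_y generator f y.
  have [] := @dominated_convergence _ _ _ (p t x) _ measurableT
    (fun n y => (D (h n) y / h n)%:E) (fun y => (generator f y)%:E)
    (cst (2 * K * C)%:E).
  - by move=> n; exact: measurable_fun_discrete.
  - exact: measurable_fun_discrete.
  - apply: aeW => y _; apply: cvg_EFin; first exact: nearW.
    have /cvg_at_rightP := @cvg_generator f K y fK.
    by apply; split.
  - exact: (integrable_bounded mS (p1 t x) (K := `|2 * K * C|)).
  - apply: aeW => y n _; rewrite lee_fin normrM (gtr0_norm (_ : 0 < (h n)^-1)).
      by rewrite ler_pdivrMr// DK// ltW.
    by rewrite invr_gt0.
  move=> _ _; rewrite -(EFin_Rintegral mS); first exact: fine_cvg.
  exact: (integrable_bounded mS (p1 t x) genK).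
have gc : \int[p t x]_y generator f y < c + e.
  by rewrite (le_lt_trans (Lc t _)) ?ltrDl// t0 ltW.
have /= [N _ HN] := cvgr_lt _ dct _ gc.
exists (h N); rewrite h0/=; split.
  by rewrite ler_pdivrMr// ler_peMr ?ler1n// ltW.
have hN0 := ltW (h0 N).
rewrite incr// -ler_pdivrMr// -RintegralZr//; first exact/ltW/HN/leqnn.
apply: (integrable_bounded mS (p1 t x) (K := 2 * K * C * h N)) => y.
exact: DK.
Qed.

(** * Moments of an observable with bounded jumps and constant drift *)

Context (g : S -> R) (delta : R).
Hypothesis g_jump : forall k x, `|g (tau k x) - g x| <= 1.
Hypothesis g_drift : forall x, generator g x = delta.

Let trunc (x : S) (K : R) (y : S) : R := Num.min `|g y - g x| K.

Let trunc_ge0 x K y : 0 <= K -> 0 <= trunc x K y.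
Proof. by move=> K0; rewrite /trunc le_min normr_ge0. Qed.

Let trunc_le x K y : trunc x K y <= K.
Proof. by rewrite /trunc ge_min lexx orbT. Qed.

Let normr_trunc x K y : 0 <= K -> `|trunc x K y| <= K.
Proof. by move=> K0; rewrite ger0_norm// trunc_ge0. Qed.

Let trunc_jump x K k y : 0 <= K -> `|trunc x K (tau k y) - trunc x K y| <= 1.
Proof.
move=> K0; apply: le_trans (g_jump k y).
have -> : g (tau k y) - g y = (g (tau k y) - g x) - (g y - g x) by ring.
apply: le_trans (ler_dist_dist _ _); exact: normr_minB_le.
Qed.

Let trunc_start x K : 0 <= K -> trunc x K x = 0.
Proof. by move=> K0; rewrite /trunc subrr normr0 (min_idPl K0). Qed.

(** Truncated distance is 1-Lipschitz in [g], so each move changes it by at most 1 and its generator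
    is at most [C]; Dynkin's inequality concludes. *)
Lemma expectation_trunc_le (x : S) (K T : R) : 0 <= K -> 0 <= T ->
  \int[p T x]_y Num.min `|g y - g x| K <= C * T.
Proof.
move=> K0 T0.
have LC y : `|generator (trunc x K) y| <= C.
  rewrite -[leRHS]mul1r; apply: normr_generator_le => // k.
  exact: trunc_jump.
have := @dynkin_le (trunc x K) K T C x T0.
rewrite trunc_start// add0r; apply.
  by move=> y; exact: normr_trunc.
move=> s _; apply: (Rintegral_le_cst mS (p1 s x) LC) => y.
exact: le_trans (ler_norm _) (LC y).
Qed.

(** A step from v to u with |u - v| <= 1 changes the square by at most 2v + 1, so the generator of
    the square has mean at most C (2 C s + 1) at time s, by the first moment bound. *)
Lemma expectation_trunc_sqr_le (x : S) (K T : R) : 0 <= K -> 0 <= T ->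
  \int[p T x]_y Num.min `|g y - g x| K ^+ 2 <= C * (2 * C * T + 1) * T.
Proof.
move=> K0 T0; have c0 := rate_bound_ge0 x.
pose W y := trunc x K y ^+ 2.
have WK y : `|W y| <= K ^+ 2.
  by rewrite /W normrX lerXn2r ?nnegrE// normr_trunc.
have LW y : `|generator W y| <= (2 * trunc x K y + 1) * C.
  have t0 := trunc_ge0 x y K0.
  apply: normr_generator_le; first by rewrite addr_ge0// mulr_ge0.
  move=> k; rewrite /W subr_sqr normrM.
  have := trunc_jump x k y K0; set u := trunc x K (tau k y); set v := trunc x K y.
  move=> uv; rewrite -[leRHS]mul1r ler_pM//.
  have u0 : 0 <= u := trunc_ge0 x _ K0.
  rewrite ger0_norm ?addr_ge0//.
  by move: uv; rewrite ler_norml; lra.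
have := @dynkin_le W (K ^+ 2) T
  (C * (2 * C * T + 1)) x T0 WK.
have -> : W x = 0 by rewrite /W trunc_start// expr0n.
rewrite add0r; apply.
move=> s /andP[s0 sT].
have ti := integrable_bounded mS (p1 s x) (fun y => normr_trunc x y K0).
have ci (c : R) : (p s x).-integrable [set: S] (EFin \o cst c).
  exact: (integrable_bounded mS (p1 s x) (K := `|c|)).
apply: (@le_trans _ _ (\int[p s x]_y ((2 * trunc x K y + 1) * C))).
  apply: le_Rintegral => //.
  - apply: (integrable_bounded mS (p1 s x) (K := (2 * K + 1) * C)) => y.
    apply: le_trans (LW y) _; rewrite ler_wpM2r// lerD2r ler_wpM2l//.
  - apply: (integrable_bounded mS (p1 s x) (K := (2 * K + 1) * C)) => y.
    have t0 := trunc_ge0 x y K0.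
    rewrite ger0_norm; last by rewrite mulr_ge0// addr_ge0// mulr_ge0.
    by rewrite ler_wpM2r// lerD2r ler_wpM2l.
  - by move=> y _; apply: le_trans (ler_norm _) (LW y).
have t2i : (p s x).-integrable [set: S] (EFin \o (fun y => 2 * trunc x K y)).
  apply: (integrable_bounded mS (p1 s x) (K := 2 * K)) => y.
  by rewrite normrM ger0_norm// ler_wpM2l// normr_trunc.
rewrite RintegralZr//; last first.
  apply: (integrable_bounded mS (p1 s x) (K := 2 * K + 1)) => y.
  rewrite (le_trans (ler_normD _ _))// normr1 lerD2r normrM ger0_norm//.
  by rewrite ler_wpM2l// normr_trunc.
rewrite RintegralD//; last exact: ci.
rewrite RintegralZl// (Rintegral_cst_prob mS (p1 s x)).
have := expectation_trunc_le x K0 s0; rewrite -/(trunc x K) => h.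
rewrite mulrC ler_wpM2l// lerD2r -mulrA ler_wpM2l//.
by apply: le_trans h _; rewrite ler_wpM2l.
Qed.

(** Quadratic in [T], since the increment is not yet centred. *)
Definition second_moment_bound (T : R) := C * (2 * C * T + 1) * T.

(** The bound for truncated squares does not involve the truncation level, which is sent to
    infinity. *)
Lemma second_moment_le (x : S) (T : R) : 0 <= T ->
  (\int[p T x]_y ((g y - g x) ^+ 2)%:E <= (second_moment_bound T)%:E)%E.
Proof.
move=> T0.
apply: (@ge0_integral_le_eventually _ _ _ mS _
  (fun n y => trunc x n%:R y ^+ 2)).
- by move=> n y; rewrite sqr_ge0.
- move=> y m n mn; rewrite lerXn2r ?nnegrE ?trunc_ge0// /trunc.
  by rewrite le_min !ge_min lexx/= ler_nat mn orbT.
- move=> y; near=> n; rewrite /trunc (min_idPl _); first by rewrite real_normK ?num_real.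
  near: n; exact: nbhs_infty_ger.
- move=> n; rewrite -(EFin_Rintegral mS); last first.
    apply: (integrable_bounded mS (p1 T x) (K := n%:R ^+ 2)) => y.
    by rewrite normrX lerXn2r ?nnegrE// normr_trunc.
  by rewrite lee_fin; exact: expectation_trunc_sqr_le.
Unshelve. all: by end_near. Qed.

Lemma integrable_sqr_increment (x : S) (T : R) : 0 <= T ->
  (p T x).-integrable [set: S] (EFin \o (fun y => (g y - g x) ^+ 2)).
Proof.
move=> T0; apply/integrableP; split; first exact: measurable_fun_discrete.
apply: (@le_lt_trans _ _ (second_moment_bound T)%:E); last exact: ltry.
apply: le_trans (second_moment_le x T0).
by under eq_integral do rewrite /= ger0_norm ?sqr_ge0//.
Qed.

(** Domination by |u| <= u^2 + 1. *)
Lemma integrable_increment (x : S) (T : R) : 0 <= T ->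
  (p T x).-integrable [set: S] (EFin \o (fun y => g y - g x)).
Proof.
move=> T0.
apply: (@le_integrable _ _ _ _ _ measurableT _
  (fun y => ((g y - g x) ^+ 2)%:E + 1%:E)%E).
- exact: measurable_fun_discrete.
- move=> y _ /=; rewrite lee_fin [leRHS]ger0_norm ?addr_ge0 ?sqr_ge0//.
  rewrite -[X in _ <= X + _]real_normK ?num_real//.
  set u := `|_|; have : 0 <= u by exact: normr_ge0.
  nra.
- apply: integrableD => //; first exact: integrable_sqr_increment.
  exact: (integrable_bounded mS (p1 T x) (K := `|1|)).
Qed.

Lemma Rintegral_sqr_increment_le (x : S) (T : R) : 0 <= T ->
  \int[p T x]_y (g y - g x) ^+ 2 <= second_moment_bound T.
Proof.
move=> T0; rewrite -lee_fin (EFin_Rintegral mS); first exact: second_moment_le.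
exact: integrable_sqr_increment.
Qed.

Let expectation_near_const (h : S -> R) (A a b K : R) (x : S) (s : R) :
  0 <= K -> 0 <= b -> 0 <= s -> (forall y, `|h y| <= A) ->
  (forall y, h y <= a + b * Num.min `|g y - g x| K) ->
  \int[p s x]_y h y <= a + b * (C * s).
Proof.
move=> K0 b0 s0 hA hb.
have ti : (p s x).-integrable [set: S] (EFin \o (fun y => Num.min `|g y - g x| K)).
  apply: (integrable_bounded mS (p1 s x) (K := K)) => y.
  by rewrite ger0_norm ?le_min ?normr_ge0// ge_min lexx orbT.
have ci (c : R) : (p s x).-integrable [set: S] (EFin \o cst c).
  exact: (integrable_bounded mS (p1 s x) (K := `|c|)).
have bti : (p s x).-integrable [set: S]
    (EFin \o (fun y => b * Num.min `|g y - g x| K)).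
  exact: (integrableZl measurableT b ti).
apply: (@le_trans _ _ (\int[p s x]_y (a + b * Num.min `|g y - g x| K))).
  apply: le_Rintegral => //; first exact: (integrable_bounded mS (p1 s x) hA).
  exact: (integrableD measurableT (ci a) bti).
rewrite RintegralD//; last exact: ci.
rewrite RintegralZl// (Rintegral_cst_prob mS (p1 s x)).
by rewrite lerD2l ler_wpM2l// expectation_trunc_le.
Qed.

(* Clipping changes the generator only where [|g y - g x|] is large, an event
   whose weight is controlled by the truncated first moment. *)
Lemma expectation_clip (x : S) (T : R) (n : nat) : 0 <= T ->
  `|\int[p T x]_y clip n.+2%:R (g y - g x) - delta * T|
    <= 2 * C ^+ 2 * T ^+ 2 / n.+1%:R.
Proof.
move=> T0; have c0 := rate_bound_ge0 x.
have n0 : 0 < n.+1%:R :> R by rewrite ltr0n.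
have K0 : 0 <= n.+2%:R :> R by rewrite ler0n.
set K : R := n.+2%:R; have K1 : K = n.+1%:R + 1 by rewrite /K -natr1.
pose G y := clip K (g y - g x).
have GK y : `|G y| <= K by exact: normr_clip_le.
have Gjump k y : `|G (tau k y) - G y| <= 1.
  apply: le_trans (normr_clipB_le _ _ _) _.
  by rewrite opprB addrA subrK.
have LG y : `|generator G y| <= 1 * C.
  by apply: normr_generator_le.
have dC : `|delta| <= 1 * C.
  by rewrite -(g_drift x); apply: normr_generator_le.
(* Within distance [n.+1] a jump of size at most 1 stays within [n.+2], where [clip] is the
   identity. Beyond it the minimum is at least [n.+1], so the right side is at least the trivial
   bound [2 * C]. *)
have near_delta y : `|generator G y - delta|
    <= 2 * C / n.+1%:R * Num.min `|g y - g x| K.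
  have [small|large] := lerP `|g y - g x| n.+1%:R.
    have -> : generator G y = delta.
      rewrite -(g_drift y); apply: eq_bigr => k _; rewrite /G !clip_id//.
      - by rewrite opprB addrA subrK.
      - by rewrite (le_trans small)// K1 lerDl.
      - rewrite (_ : _ - _ = (g (tau k y) - g y) + (g y - g x)); last by ring.
        by rewrite K1 addrC (le_trans (ler_normD _ _))// lerD.
    rewrite subrr normr0 mulr_ge0 ?le_min ?normr_ge0//.
    by rewrite divr_ge0 ?mulr_ge0// ltW.
  rewrite (le_trans (ler_normB _ _))// (le_trans (lerD (LG y) dC))//.
  rewrite mul1r -mulr2n -(mulr_natl C) -[leRHS]mulrA ler_peMr ?mulr_ge0//.
  by rewrite mulrC ler_pdivlMr// mul1r le_min (ltW large) K1 lerDl ler01.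
(* The signs 1 and -1 turn the one-sided Dynkin inequality into a two-sided estimate. *)
have key sg : `|sg| = 1 ->
    sg * \int[p T x]_y G y <= (sg * delta + 2 * C / n.+1%:R * (C * T)) * T.
  move=> sg1.
  have Gi := integrable_bounded mS (p1 T x) GK.
  have Gx : G x = 0 by rewrite /G subrr clip_id// normr0.
  have LsG y : generator (fun y => sg * G y) y = sg * generator G y.
    rewrite mulr_sumr; apply: eq_bigr => k _.
    by rewrite -mulrBr mulrCA.
  rewrite -RintegralZl//.
  have := @dynkin_le (fun y => sg * G y) K T
    (sg * delta + 2 * C / n.+1%:R * (C * T)) x T0.
  rewrite Gx mulr0 add0r; apply.
    by move=> y; rewrite normrM sg1 mul1r.
  move=> s /andP[s0 sT].
  have b0 : 0 <= 2 * C / n.+1%:R by rewrite divr_ge0 ?mulr_ge0// ltW.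
  apply: le_trans (@expectation_near_const _ (1 * C) (sg * delta)
    (2 * C / n.+1%:R) K x s K0 b0 s0 _ _) _.
  - by move=> y; rewrite LsG normrM sg1 [1 * `|_|]mul1r; exact: LG.
  - move=> y; rewrite LsG -lerBlDl -mulrBr; apply: le_trans (near_delta y).
    by apply: le_trans (ler_norm _) _; rewrite normrM sg1 mul1r.
  - by rewrite lerD2l ler_wpM2l// ler_wpM2l.
have := key 1 (normr1 _); have := key (-1) (normrN1 _).
rewrite !mulN1r !mul1r -/G => k1 k2.
have -> : 2 * C ^+ 2 * T ^+ 2 / n.+1%:R = 2 * C / n.+1%:R * (C * T) * T by ring.
rewrite ler_norml; set e := 2 * C / n.+1%:R * (C * T) in k1 k2 *.
by apply/andP; split; lra.
Qed.

(** Compare with the clipped increment: its mean is within O(1/n) of [delta * T], and |u - clip K u|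
    <= u^2 / K bounds the clipping error through the second moment. Letting n grow gives
    equality. *)
Lemma Rintegral_increment (x : S) (T : R) : 0 <= T ->
  \int[p T x]_y (g y - g x) = delta * T.
Proof.
move=> T0; set m := Rintegral _ _ _; have c0 := rate_bound_ge0 x.
set B := 2 * C ^+ 2 * T ^+ 2 + second_moment_bound T.
suff key n : `|m - delta * T| <= B / n.+1%:R.
  apply/eqP; rewrite -subr_eq0 -normr_le0; apply/ler_addgt0Pr => e e0.
  have /= [N _ HN] : \forall n \near \oo, B * n.+1%:R^-1 < e :> R.
    apply: (cvgr_lt 0) => //; rewrite -(mulr0 B).
    by apply: cvgMr; exact: cvg_harmonic.
  by rewrite add0r (le_trans (key N))// ltW// HN/=.
have -> : m - delta * T = (\int[p T x]_y clip n.+2%:R (g y - g x) - delta * T)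
    + (m - \int[p T x]_y clip n.+2%:R (g y - g x)) by ring.
rewrite mulrDl (le_trans (ler_normD _ _))// lerD ?expectation_clip//.
have K0 : 0 < n.+2%:R :> R by rewrite ltr0n.
have gi := integrable_increment x T0.
have ci := integrable_bounded mS (p1 T x)
  (fun y => normr_clip_le (g y - g x) (ltW K0)).
have g2i := integrable_sqr_increment x T0.
rewrite -RintegralB//; apply: le_trans (le_normr_Rintegral _ _) _ => //.
  exact: (integrableB measurableT gi ci).
apply: (@le_trans _ _ (\int[p T x]_y ((g y - g x) ^+ 2 / n.+2%:R))).
  apply: le_Rintegral => //.
  - exact/integrable_norm/(integrableB measurableT gi ci).
  - exact: (integrableZr measurableT _ g2i).
  - move=> y _; have [small|large] := lerP `|g y - g x| n.+2%:R.
      by rewrite clip_id// subrr normr0 divr_ge0 ?sqr_ge0// ltW.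
    rewrite ler_pdivlMr// -real_normK ?num_real// expr2.
    by rewrite ler_pM ?normr_ge0 ?(ltW large)// normr_sub_clip_le// ltW.
rewrite RintegralZr//; apply: ler_pM.
- by apply: Rintegral_ge0 => y _; exact: sqr_ge0.
- by rewrite invr_ge0 ltW.
- exact: Rintegral_sqr_increment_le.
- by rewrite lef_pV2 ?posrE ?ltr0n// ler_nat.
Qed.

(** Comes from (u - v)^2 <= 2 u^2 + 2 v^2, with u the increment and v its drift over one unit of
    time. *)
Definition variance_bound : R := 2 * second_moment_bound 1 + 2 * delta ^+ 2.

Let integrable_centred (x : S) (T : R) : 0 <= T ->
  (p T x).-integrable [set: S] (EFin \o (fun y => g y - g x - delta * T)).
Proof.
move=> T0; have gi := integrable_increment x T0.
have ci : (p T x).-integrable [set: S] (EFin \o cst (delta * T)).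
  exact: (integrable_bounded mS (p1 T x) (K := `|delta * T|)).
exact: (integrableB measurableT gi ci).
Qed.

Lemma Rintegral_centred (x : S) (T : R) : 0 <= T ->
  \int[p T x]_y (g y - g x - delta * T) = 0.
Proof.
move=> T0; rewrite RintegralB//; first last.
- exact: (integrable_bounded mS (p1 T x) (K := `|delta * T|)).
- exact: integrable_increment.
by rewrite (Rintegral_cst_prob mS (p1 T x)) Rintegral_increment// subrr.
Qed.

Let integrable_sqr_centred (x : S) (T : R) : 0 <= T ->
  (p T x).-integrable [set: S] (EFin \o (fun y => (g y - g x - delta * T) ^+ 2)).
Proof.
move=> T0.
apply: (@le_integrable _ _ _ _ _ measurableT _
  (EFin \o (fun y => 2 * (g y - g x) ^+ 2 + 2 * (delta * T) ^+ 2))).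
- exact: measurable_fun_discrete.
- move=> y _ /=; rewrite lee_fin ger0_norm ?sqr_ge0//.
  rewrite [leRHS]ger0_norm; last by rewrite addr_ge0// mulr_ge0 ?sqr_ge0.
  (* 2 u^2 + 2 v^2 - (u - v)^2 = (u + v)^2. *)
  by rewrite -subr_ge0 (_ : _ - _ = (g y - g x + delta * T) ^+ 2) ?sqr_ge0//; ring.
- have g2i := integrable_sqr_increment x T0.
  have ci : (p T x).-integrable [set: S] (EFin \o cst (2 * (delta * T) ^+ 2)).
    exact: (integrable_bounded mS (p1 T x) (K := `|2 * (delta * T) ^+ 2|)).
  have g2i2 : (p T x).-integrable [set: S] (EFin \o (fun y => 2 * (g y - g x) ^+ 2)).
    exact: (integrableZl measurableT 2 g2i).
  exact: (integrableD measurableT g2i2 ci).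
Qed.

Lemma Rintegral_sqr_centred_le1 (x : S) (T : R) : 0 <= T <= 1 ->
  \int[p T x]_y (g y - g x - delta * T) ^+ 2 <= variance_bound.
Proof.
move=> /andP[T0 T1]; have c0 := rate_bound_ge0 x.
have g2i := integrable_sqr_increment x T0.
have ci : (p T x).-integrable [set: S] (EFin \o cst (2 * (delta * T) ^+ 2)).
  exact: (integrable_bounded mS (p1 T x) (K := `|2 * (delta * T) ^+ 2|)).
have g2i2 : (p T x).-integrable [set: S] (EFin \o (fun y => 2 * (g y - g x) ^+ 2)).
  exact: (integrableZl measurableT 2 g2i).
apply: (@le_trans _ _
  (\int[p T x]_y (2 * (g y - g x) ^+ 2 + 2 * (delta * T) ^+ 2))).
  apply: le_Rintegral => //; first exact: integrable_sqr_centred.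
    exact: (integrableD measurableT g2i2 ci).
  move=> y _; rewrite -subr_ge0.
  by rewrite (_ : _ - _ = (g y - g x + delta * T) ^+ 2) ?sqr_ge0//; ring.
rewrite RintegralD// (Rintegral_cst_prob mS (p1 T x)) RintegralZl//.
have T2 : T ^+ 2 <= 1 by rewrite expr_le1.
apply: lerD; rewrite ler_wpM2l//.
  apply: le_trans (Rintegral_sqr_increment_le x T0) _.
  have cT : 0 <= 2 * C * T by rewrite !mulr_ge0.
  have cT1 : C * (2 * C * T + 1) <= C * (2 * C * 1 + 1).
    by rewrite ler_wpM2l// lerD2r ler_wpM2l// mulr_ge0.
  by rewrite /second_moment_bound ler_pM// mulr_ge0// addr_ge0.
by rewrite exprMn ler_piMr// sqr_ge0.
Qed.

(* The increments over [0, 1] and [1, 1 + s] are orthogonal, so the centred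
   second moments add up. *)
Lemma integral_sqr_centred_le (x : S) (n : nat) (T : R) : 0 <= T <= n.+1%:R ->
  (\int[p T x]_y ((g y - g x - delta * T) ^+ 2)%:E
    <= (variance_bound * n.+1%:R)%:E)%E.
Proof.
have base (z : S) (t : R) : 0 <= t <= 1 ->
    (\int[p t z]_y ((g y - g z - delta * t) ^+ 2)%:E <= variance_bound%:E)%E.
  move=> t01; rewrite -(EFin_Rintegral mS); last first.
    by apply: integrable_sqr_centred; case/andP: t01.
  by rewrite lee_fin; exact: Rintegral_sqr_centred_le1.
(* Induction on the number of unit time steps needed to cover [T], for all starting points at
   once. *)
elim: n x T => [|n IH] x T; first by rewrite mulr1; exact: base.
move=> /andP[T0 Tn].
have v0 : 0 <= variance_bound.
  apply: le_trans (Rintegral_sqr_centred_le1 x (T := 0) _); last by rewrite lexx ler01.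
  by apply: Rintegral_ge0 => y _; exact: sqr_ge0.
have [T1|T1] := leP T 1.
  apply: le_trans (base _ _ _) _; first by rewrite T0.
  by rewrite lee_fin ler_peMr// ler1n.
pose s := T - 1; have -> : T = 1 + s by rewrite /s addrC subrK.
have s0 : 0 <= s by rewrite /s subr_ge0 ltW.
have sn : s <= n.+1%:R by rewrite /s lerBlDr natr1.
rewrite (ge0_integral_semigroup mS hp)//; last by move=> y; rewrite lee_fin sqr_ge0.
(* Given the state [y] at time 1, the square expands around the constant [A]; the cross term
   vanishes by [Rintegral_centred] and the last square falls under the induction hypothesis. *)
have step y : (\int[p s y]_z ((g z - g x - delta * (1 + s)) ^+ 2)%:E
    <= ((g y - g x - delta * 1) ^+ 2 + variance_bound * n.+1%:R)%:E)%E.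
  set A := g y - g x - delta * 1.
  have bi := integrable_centred y s0; have b2i := integrable_sqr_centred y s0.
  have bAi : (p s y).-integrable [set: S]
      (EFin \o (fun z => 2 * A * (g z - g y - delta * s))).
    exact: (integrableZl measurableT (2 * A) bi).
  have ci : (p s y).-integrable [set: S] (EFin \o cst (A ^+ 2)).
    exact: (integrable_bounded mS (p1 s y) (K := `|A ^+ 2|)).
  have i2 : (p s y).-integrable [set: S] (EFin \o (fun z =>
      2 * A * (g z - g y - delta * s) + (g z - g y - delta * s) ^+ 2)).
    exact: (integrableD measurableT bAi b2i).
  have e : (\int[p s y]_z ((g z - g x - delta * (1 + s)) ^+ 2)%:E =
      (\int[p s y]_z (A ^+ 2 + (2 * A * (g z - g y - delta * s)
         + (g z - g y - delta * s) ^+ 2)))%:E)%E.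
    rewrite (EFin_Rintegral mS); last exact: (integrableD measurableT ci i2).
    by apply: eq_integral => z _; congr EFin; rewrite /A; ring.
  rewrite e RintegralD// (Rintegral_cst_prob mS (p1 s y)) RintegralD// RintegralZl//.
  rewrite Rintegral_centred// mulr0 add0r lee_fin lerD2l -lee_fin.
  rewrite (EFin_Rintegral mS)//; apply: IH; by rewrite s0.
apply: (@le_trans _ _ (\int[p 1 x]_y ((g y - g x - delta * 1) ^+ 2
    + variance_bound * n.+1%:R)%:E)%E).
  apply: ge0_le_integral => //.
  - by move=> y _; apply: integral_ge0 => z _; rewrite lee_fin sqr_ge0.
under eq_integral do rewrite EFinD.
rewrite ge0_integralD//; first last.
- by move=> y _; rewrite lee_fin mulr_ge0.
- by move=> y _; rewrite lee_fin sqr_ge0.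
rewrite integral_cst// p1 mule1 -(natr1 n.+1) mulrDr [variance_bound * 1]mulr1.
rewrite addrC EFinD leeD//.
by apply: base; rewrite ler01 lexx.
Qed.

Lemma chebyshev_transition (x : S) (n : nat) (T lam : R) :
  (0 < n)%N -> 0 <= T <= n%:R -> 0 < lam ->
  (p T x [set y | (lam <= `|g y - g x - delta * T|)%R]
    <= (variance_bound * n%:R / lam ^+ 2)%:E)%E.
Proof.
case: n => // n _ Tn lam0; set A := [set y | _].
have l2 : 0 < lam ^+ 2 by rewrite exprn_gt0.
rewrite -(@lee_pmul2l _ (lam ^+ 2)%:E)// -EFinM mulrC divfK ?gt_eqF//.
apply: le_trans (integral_sqr_centred_le x Tn).
rewrite -integral_cst//.
apply: (@le_trans _ _ (\int[p T x]_(y in A) ((g y - g x - delta * T) ^+ 2)%:E)%E).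
  apply: ge0_le_integral => //.
  - by move=> y _; rewrite lee_fin ltW.
  - move=> y /= Ay; rewrite lee_fin -[leRHS]real_normK ?num_real//.
    by rewrite lerXn2r ?nnegrE ?(ltW lam0).
apply: ge0_subset_integral => //.
- by move=> y _; rewrite lee_fin sqr_ge0.
Qed.

End JumpProcess.

(** * The Markov property for sets of past states *)

Section CountableSpace.
Context {R : realType} {d : measure_display} {S : measurableType d}.
Hypothesis mS : forall A : set S, measurable A.
Context (code : S -> nat) (code_inj : injective code).

(** Formulated for bare set functions, so that joint probabilities and scaled kernels can be
    compared without being built as measures. All subsets of [S] are measurable here. *)
Definition countably_additive (phi : set S -> \bar R) :=
  [/\ phi set0 = 0%E, forall A, (0 <= phi A)%E &
    forall F : (set S)^nat, trivIset [set: nat] F ->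
      phi (\bigcup_n F n) = (\sum_(n <oo) phi (F n))%E].

(** The injective [code] cuts [A] into countably many pieces, each empty or a singleton. *)
Lemma le_countably_additive (phi psi : set S -> \bar R) :
  countably_additive phi -> countably_additive psi ->
  (forall y, phi [set y] <= psi [set y])%E -> forall A, (phi A <= psi A)%E.
Proof.
move=> [phi0 phi_ge0 phiU] [psi0 _ psiU] pts A.
pose F n := A `&` code @^-1` [set n].
have -> : A = \bigcup_n F n.
  by apply/seteqP; split=> [y Ay|y [n _ []]]//; exists (code y).
have tF : trivIset setT F by move=> i j _ _ [y [[_ <-] [_ <-]]].
rewrite phiU// psiU//; apply: lee_nneseries => // n _.
have [[y [Ay yn]]|/set0P/negP/negPn/eqP->] := pselect (F n !=set0); last first.
  by rewrite phi0 psi0.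
rewrite (_ : F n = [set y])//; apply/seteqP; split=> [z [_ zn]|z ->] //.
by apply: code_inj; rewrite zn yn.
Qed.

Lemma eq_countably_additive (phi psi : set S -> \bar R) :
  countably_additive phi -> countably_additive psi ->
  (forall y, phi [set y] = psi [set y]) -> forall A, phi A = psi A.
Proof.
move=> aphi apsi pts A; apply/eqP; rewrite eq_le.
by rewrite !le_countably_additive// => y; rewrite pts.
Qed.

Lemma countably_additive_measure (mu : {measure set S -> \bar R}) :
  countably_additive mu.
Proof. by split=> // F tF; rewrite measure_semi_bigcup. Qed.

Lemma countably_additive_scale (phi : set S -> \bar R) (c : R) :
  0 <= c -> countably_additive phi ->
  countably_additive (fun A => (c%:E * phi A)%E).
Proof.
move=> c0 [phi0 phi_ge0 phiU]; split=> [|A|F tF].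
- by rewrite phi0 mule0.
- by rewrite mule_ge0.
- by rewrite phiU// nneseriesZl.
Qed.

Lemma countably_additive_event {d'} {T : measurableType d'}
    (P : {measure set T -> \bar R}) (H : set T) (Y : T -> S) :
  measurable H -> measurable_fun [set: T] Y ->
  countably_additive (fun A => P (H `&` Y @^-1` A)).
Proof.
move=> mH mY.
have mYA A : measurable (Y @^-1` A) by rewrite -[_ @^-1` _]setTI; exact: mY.
split=> [|A|F tF].
- by rewrite preimage_set0 setI0 measure0.
- exact: measure_ge0.
- rewrite preimage_bigcup setI_bigcupr measure_semi_bigcup//.
  + by move=> n; exact: measurableI.
  + move=> i j _ _ [w [[_ Fi] [_ Fj]]]; apply: tF => //.
    by exists (Y w).
  + by apply: bigcupT_measurable => n; exact: measurableI.
Qed.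

End CountableSpace.

Section MarkovProperty.
Context {R : realType} {d : measure_display} {S : measurableType d}.
Hypothesis mS : forall A : set S, measurable A.
Context (code : S -> nat) (code_inj : injective code).
Context {d' : measure_display} {T : measurableType d'} (P : probability T R).
Context (p : R -> R.-pker S ~> S) (x0 : S) (X : R -> T -> S).
Hypothesis hX : is_markov_chain P p x0 X.

Lemma measurable_chain_event t (A : set S) : 0 <= t ->
  measurable (X t @^-1` A).
Proof.
by move=> t0; rewrite -[_ @^-1` _]setTI; apply: (chain_measurable hX t0).
Qed.

Lemma measurable_points_event (past : seq (R * S)) :
  (forall u, u \in past -> 0 <= u.1) ->
  measurable [set w | forall u, u \in past -> X u.1 w = u.2].
Proof.
elim: past => [|u past IH] past0.
  by rewrite (_ : [set _ | _] = setT)//; apply/seteqP; split.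
rewrite (_ : [set _ | _] = X u.1 @^-1` [set u.2] `&`
    [set w | forall u, u \in past -> X u.1 w = u.2]).
  apply: measurableI; first by apply: measurable_chain_event; apply: past0; rewrite mem_head.
  by apply: IH => v vp; apply: past0; rewrite in_cons vp orbT.
apply/seteqP; split=> [w h|w [h1 h2] v].
- split; first by apply: h; rewrite mem_head.
  by move=> v vp; apply: h; rewrite in_cons vp orbT.
- by rewrite in_cons => /predU1P[->//|]; exact: h2.
Qed.

Lemma measurable_sets_event (ts : seq R) (B : R -> set S) :
  (forall u, u \in ts -> 0 <= u) ->
  measurable [set w | forall u, u \in ts -> B u (X u w)].
Proof.
elim: ts => [|u ts IH] ts0.
  by rewrite (_ : [set _ | _] = setT)//; apply/seteqP; split.
rewrite (_ : [set _ | _] = X u @^-1` (B u) `&`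
    [set w | forall u, u \in ts -> B u (X u w)]).
  apply: measurableI; first by apply: measurable_chain_event; apply: ts0; rewrite mem_head.
  by apply: IH => v vp; apply: ts0; rewrite in_cons vp orbT.
apply/seteqP; split=> [w h|w [h1 h2] v].
- split; first by apply: h; rewrite mem_head.
  by move=> v vp; apply: h; rewrite in_cons vp orbT.
- by rewrite in_cons => /predU1P[->//|]; exact: h2.
Qed.

(** Set constraints are turned into point constraints one time at a time. Both sides are countably
    additive in the set imposed at that time, so singletons suffice and move to [past]; once none is
    left, additivity in [A] reduces to [chain_markov]. *)
Let markov_sets_points (past : seq (R * S)) (ts : seq R) (B : R -> set S)
    (s h : R) (x : S) (A : set S) :
  0 <= s -> 0 <= h -> (forall u, u \in past -> 0 <= u.1 <= s) ->
  (forall u, u \in ts -> 0 <= u <= s) ->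
  let history := [set w | forall u, u \in past -> X u.1 w = u.2] `&`
    ([set w | forall u, u \in ts -> B u (X u w)] `&` X s @^-1` [set x]) in
  P (history `&` X (s + h) @^-1` A) = (P history * p h x A)%E.
Proof.
move=> s0 h0; elim: ts past => [|u ts IH] past past_s ts_s history.
  have sh0 : 0 <= s + h by exact: addr_ge0.
  have hE : history =
      [set w | (forall u, u \in past -> X u.1 w = u.2) /\ X s w = x].
    by apply/seteqP; split=> [w [h1 [_ h2]]|w [h1 h2]]//; split.
  have mh : measurable history.
    apply: measurableI; first by apply: measurable_points_event => u /past_s/andP[].
    apply: measurableI; first exact: measurable_sets_event.
    exact: measurable_chain_event.
  have fh : P history \is a fin_num by exact: fin_num_measure.
  rewrite -(fineK fh).
  have a1 := countably_additive_event mS P mh (chain_measurable hX sh0).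
  have a2 := countably_additive_scale (fine_ge0 (measure_ge0 P history))
    (countably_additive_measure mS (p h x)).
  apply: (eq_countably_additive code_inj a1 a2) => y.
  by rewrite fineK// hE; exact: (chain_markov hX).
have u_s : 0 <= u <= s by apply: ts_s; rewrite mem_head.
have ts_s' v : v \in ts -> 0 <= v <= s by move=> vt; apply: ts_s; rewrite in_cons vt orbT.
have [u0 _] := andP u_s.
pose H := [set w | forall u, u \in past -> X u.1 w = u.2] `&`
    ([set w | forall u, u \in ts -> B u (X u w)] `&` X s @^-1` [set x]).
have mH : measurable H.
  apply: measurableI; first by apply: measurable_points_event => v /past_s/andP[].
  apply: measurableI; last exact: measurable_chain_event.
  by apply: measurable_sets_event => v /ts_s'/andP[].
have hE : history = H `&` X u @^-1` (B u).
  apply/seteqP; split=> [w [h1 [h2 h3]]|w [[h1 [h2 h3]] h4]].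
    split; last by apply: h2; rewrite mem_head.
    by split=> //; split=> // v vt; apply: h2; rewrite in_cons vt orbT.
  by split=> //; split=> // v; rewrite in_cons => /predU1P[->//|]; exact: h2.
have mHA : measurable (H `&` X (s + h) @^-1` A).
  by apply: measurableI => //; apply: measurable_chain_event; exact: addr_ge0.
have fA : p h x A \is a fin_num by exact: finite_kernel_measure.
rewrite hE setIAC muleC -(fineK fA).
have a1 := countably_additive_event mS P mHA (chain_measurable hX u0).
have a2 := countably_additive_scale (fine_ge0 (measure_ge0 (p h x) A))
  (countably_additive_event mS P mH (chain_measurable hX u0)).
apply: (eq_countably_additive code_inj a1 a2) => y.
rewrite fineK// muleC setIAC.
have := IH ((u, y) :: past).
set H' := (X in _ -> _ -> let history := X in _).
have -> : H `&` X u @^-1` [set y] = H'.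
  apply/seteqP; split=> [w [[h1 h2] h3]|w [h1 h2]].
    by split=> // v; rewrite in_cons => /predU1P[->|]; [exact: h3|exact: h1].
  split; last by apply: (h1 (u, y)); rewrite mem_head.
  by split=> // v vp; apply: h1; rewrite in_cons vp orbT.
by apply=> // v; rewrite in_cons => /predU1P[->//|]; exact: past_s.
Qed.

Lemma markov_sets (ts : seq R) (B : R -> set S) (s h : R) (x : S) (A : set S) :
  0 <= s -> 0 <= h -> (forall u, u \in ts -> 0 <= u <= s) ->
  let history := [set w | forall u, u \in ts -> B u (X u w)] `&` X s @^-1` [set x] in
  P (history `&` X (s + h) @^-1` A) = (P history * p h x A)%E.
Proof.
move=> s0 h0 ts_s history.
have := @markov_sets_points [::] ts B s h x A s0 h0 (fun=> ltac:(by [])) ts_s.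
by rewrite /= (_ : [set _ | _] = setT) ?setTI//; apply/seteqP; split.
Qed.

(** Up to a null set the path starts at [x0], so the Markov property at time 0 applies; the factor
    P(X_0 = x0) is bounded by 1. *)
Lemma chain_law_le (t : R) (A : set S) : 0 <= t -> (P (X t @^-1` A) <= p t x0 A)%E.
Proof.
move=> t0.
have [N [mN N0 subN]] := chain_start hX.
have mst := measurable_chain_event [set x0] (lexx 0).
have := @markov_sets [::] (fun=> setT) 0 t x0 A (lexx _) t0 (fun=> ltac:(by [])).
rewrite /= (_ : [set _ | _] = setT); last by apply/seteqP; split.
rewrite setTI add0r => e.
apply: (@le_trans _ _ (P ((X 0 @^-1` [set x0] `&` X t @^-1` A) `|` N))).
  apply: le_measure; rewrite ?inE.
  - exact: measurable_chain_event.
  - by apply: measurableU => //; apply: measurableI => //; exact: measurable_chain_event.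
  - move=> w Xw; have [Nw|Nw] := pselect (N w); [by right|left; split=> //].
    by apply: contrapT => h; apply: Nw; exact: subN.
apply: le_trans (measureU2 _ _ _) _ => //.
  by apply: measurableI => //; exact: measurable_chain_event.
rewrite [X in (_ + X)%E]N0 adde0 [leLHS]e -[leRHS]mul1e; apply: lee_wpmul2r => //.
exact: probability_le1.
Qed.

(** Under [P] restricted to X_t = x, the law of X_{t+h} is the measure [p h x] scaled by P(X_t =
    x). *)
Lemma ge0_integral_chain_step (t h : R) (x : S) (f : S -> \bar R) :
  0 <= t -> 0 <= h -> (forall y, 0 <= f y)%E ->
  (\int[P]_(w in [set w | X t w = x]) f (X (t + h) w)
    = P [set w | X t w = x] * \int[p h x]_y f y)%E.
Proof.
move=> t0 h0 f0.
have th0 : 0 <= t + h by exact: addr_ge0.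
have mA : measurable [set w | X t w = x] := measurable_chain_event [set x] t0.
have mY := chain_measurable hX th0.
have mf : measurable_fun [set: S] f by exact: measurable_fun_discrete.
have mfY : measurable_fun [set: T] (fun w => f (X (t + h) w)).
  exact: (measurableT_comp mf mY).
set A := [set w | X t w = x].
have fA : P A \is a fin_num by exact: fin_num_measure.
have -> : (\int[P]_(w in A) f (X (t + h) w)
    = \int[mrestr P mA]_(w in A) f (X (t + h) w))%E.
  apply: eq_measure_integral => C mC CA.
  by rewrite /= /mrestr setIidl.
(* The restricted measure vanishes off [A], so the integral extends to the whole space and can be
   pushed forward. *)
have -> : (\int[mrestr P mA]_(w in A) f (X (t + h) w)
    = \int[mrestr P mA]_w f (X (t + h) w))%E.
  rewrite [RHS](@ge0_negligible_integral _ _ _ _ _ (~` A))//.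
  - by rewrite setTD setCK.
  - exact: measurableC.
  - by rewrite /= /mrestr setICl measure0.
have := @ge0_integral_pushforward _ _ _ _ _ _ mY (mrestr P mA) setT f measurableT mf
  (fun y _ => f0 y).
rewrite preimage_setT => <-.
have [k kE] : exists k : {nonneg R}, P A = (k%:num)%:E.
  have h1 : 0 <= fine (P A) by exact: fine_ge0.
  by exists (NngNum h1); rewrite fineK.
rewrite kE -ge0_integral_mscale//.
apply: eq_measure_integral => C mC _.
have := @markov_sets [::] (fun=> setT) t h x C t0 h0 (fun=> ltac:(by [])).
rewrite /= (_ : [set _ | _] = setT); last by apply/seteqP; split.
by rewrite setTI /pushforward /mrestr /mscale/= -kE setIC.
Qed.

End MarkovProperty.

(** * Maximal inequality and linear growth *)

Section MaximalInequality.
Context {R : realType} {d : measure_display} {S : measurableType d}.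
Hypothesis mS : forall A : set S, measurable A.
Context (code : S -> nat) (code_inj : injective code).
Context {d' : measure_display} {T : measurableType d'} (P : probability T R).
Context (p : R -> R.-pker S ~> S) (x0 : S) (X : R -> T -> S).
Hypothesis hX : is_markov_chain P p x0 X.
Context (g : S -> R) (delta v : R).
Hypothesis chebyshev : forall x (n : nat) (t lam : R),
  (0 < n)%N -> 0 <= t <= n%:R -> 0 < lam ->
  (p t x [set y | (lam <= `|g y - g x - delta * t|)%R]
    <= (v * n%:R / lam ^+ 2)%:E)%E.

Definition centred_path (t : R) (w : T) : R := g (X t w) - g x0 - delta * t.

Let D := centred_path.

Let measurable_level (lam t : R) : 0 <= t ->
  measurable [set w | lam <= `|D t w|].
Proof.
exact: (measurable_chain_event mS hX [set y | lam <= `|g y - g x0 - delta * t|]).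
Qed.

(** The earlier times are listed so that the condition on them has the form used in
    [markov_sets]. *)
Definition first_passage (t : nat -> R) (k : nat) (lam : R) : set T :=
  [set w | forall u, u \in [seq t i | i <- iota 0 k] -> `|D u w| < 2 * lam]
    `&` [set w | 2 * lam <= `|D (t k) w|].

(* Ottaviani: at the first index [k] where the path has size at least [2 * lam],
   the remaining increment is smaller than [lam] with probability at least 1/2,
   and then the terminal value still has size at least [lam]. *)
Let first_passage_le (t : nat -> R) (n k : nat) (lam : R) :
  (0 < n)%N -> 0 < lam -> {homo t : i j / (i <= j)%N >-> i <= j} ->
  (forall i, 0 <= t i <= n%:R) -> v * n%:R / lam ^+ 2 <= 2^-1 ->
  (P (first_passage t k lam)
    <= 2%:E * P (first_passage t k lam `&` [set w | (lam <= `|D n%:R w|)%R]))%E.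
Proof.
move=> n0 lam0 tnd tn half; set E := first_passage t k lam; set F := [set w | lam <= _].
have /andP[tk0 tkn] := tn k.
pose B u := [set y | `|g y - g x0 - delta * u| < 2 * lam].
pose H := [set w | forall u, u \in [seq t i | i <- iota 0 k] -> B u (X u w)].
have ts_le u : u \in [seq t i | i <- iota 0 k] -> 0 <= u <= t k.
  move=> /mapP[i]; rewrite mem_iota add0n => /andP[_ ik] ->.
  by rewrite tnd ?(ltnW ik)// andbT; case/andP: (tn i).
have mH : measurable H.
  by apply: (measurable_sets_event mS hX B) => u /ts_le/andP[].
have mE : measurable E by apply: measurableI => //; exact: measurable_level.
have mF : measurable F by exact: measurable_level.
have mEF : measurable (E `&` F) by exact: measurableI.
(* Both sides are countably additive in the set of states allowed at time [t k], so a single state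
   [y] can be fixed there. *)
have a1 := countably_additive_event mS P mE (chain_measurable hX tk0).
have a2 := countably_additive_scale (ler0n R 2)
  (countably_additive_event mS P mEF (chain_measurable hX tk0)).
have := le_countably_additive code_inj a1 a2 _ setT.
rewrite /= preimage_setT !setIT; apply=> y.
set Xy := X (t k) @^-1` [set y].
have mXy : measurable Xy by exact: (measurable_chain_event mS hX).
have [yC|yC] := lerP (2 * lam) `|g y - g x0 - delta * t k|; last first.
  rewrite (_ : E `&` Xy = set0) ?measure0 ?mule_ge0//.
  apply/seteqP; split=> // w [[_ /= Ew] /= Xw]; move: Ew yC.
  by rewrite /D /centred_path Xw => Ew; rewrite ltNge Ew.
(* Once the state [y] at time [t k] is known to be at the level, only the earlier conditions
   remain. *)
have -> : E `&` Xy = H `&` Xy.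
  by apply/seteqP; split=> w [] => [[Hw _]|Hw] Xw; split=> //; split=> //=;
    rewrite /D /centred_path Xw.
pose W := [set z | lam <= `|g z - g y - delta * (n%:R - t k)|].
have h0 : 0 <= n%:R - t k by rewrite subr_ge0.
have mkv := markov_sets mS code_inj hX B y W tk0 h0 ts_le.
rewrite /= subrKC -/H -/Xy in mkv.
have mHX : measurable (H `&` Xy) by exact: measurableI.
have mXW : measurable (X n%:R @^-1` W).
  exact: (measurable_chain_event mS hX _ (ler0n R n)).
have fH : P (H `&` Xy) \is a fin_num by exact: fin_num_measure.
have fHF : P ((E `&` F) `&` Xy) \is a fin_num.
  by apply: fin_num_measure; exact: measurableI.
have pW : (p (n%:R - t k) y W <= (2^-1)%:E)%E.
  apply: le_trans (chebyshev y n0 _ lam0) _; last by rewrite lee_fin.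
  by rewrite h0 gerBl.
(* Off [W] the remaining increment is below [lam], so the terminal value keeps size at least [lam].
   The part on [W] weighs at most half of the left side and is absorbed. *)
have split2 : (P (H `&` Xy) <= P ((E `&` F) `&` Xy) + P (H `&` Xy) * (2^-1)%:E)%E.
  rewrite [leLHS](measureDI P mHX mXW) leeD//.
    apply: le_measure; rewrite ?inE//; [exact: measurableD|exact: measurableI|].
    move=> w [[Hw Xw] /= nW]; split=> //; split.
      by split=> //=; rewrite /D /centred_path Xw.
    move/negP: nW; rewrite -ltNge => nW; rewrite /F /= leNgt; apply/negP => nF.
    move: yC; apply/negP; rewrite -ltNge.
    rewrite (_ : _ - _ = D n%:R w - (g (X n%:R w) - g y - delta * (n%:R - t k))).
      rewrite (le_lt_trans (ler_normB _ _))// mulrDl mul1r ltrD//.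
    by rewrite /D /centred_path; ring.
  rewrite [leLHS]mkv; apply: lee_wpmul2l => //.
move: split2; rewrite -(fineK fH) -(fineK fHF) -!EFinM -EFinD !lee_fin; lra.
Qed.

(** The first passage events are disjoint, so summing [first_passage_le] over them bounds the
    exceedance by twice the terminal probability, which Chebyshev controls. *)
Lemma ottaviani (t : nat -> R) (n : nat) (lam : R) :
  (0 < n)%N -> 0 < lam -> {homo t : i j / (i <= j)%N >-> i <= j} ->
  (forall i, 0 <= t i <= n%:R) ->
  (P [set w | exists k, (2 * lam <= `|D (t k) w|)%R]
    <= (2 * (v * n%:R / lam ^+ 2))%:E)%E.
Proof.
move=> n0 lam0 tnd tn; set A := [set w | _].
have t0 i : 0 <= t i by case/andP: (tn i).
have AE : A = \bigcup_k [set w | 2 * lam <= `|D (t k) w|].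
  by apply/seteqP; split=> [w [k ?]|w [k _ ?]]; exists k.
have mA : measurable A by rewrite AE; apply: bigcupT_measurable => k; exact: measurable_level.
(* When the Chebyshev bound exceeds 1/2, the claimed bound exceeds 1. *)
have [half|half] := lerP (v * n%:R / lam ^+ 2) 2^-1; last first.
  by apply: le_trans (probability_le1 P mA) _; rewrite lee_fin; move: half; lra.
pose E k := first_passage t k lam.
pose F := [set w | lam <= `|D n%:R w|].
have mF : measurable F by exact: measurable_level.
have mE k : measurable (E k).
  apply: measurableI; last exact: measurable_level.
  apply: (measurable_sets_event mS hX
    (fun u => [set y | `|g y - g x0 - delta * u| < 2 * lam])).
  by move=> u /mapP[i _ ->].
have EU : A = \bigcup_k E k.
  apply/seteqP; split=> [w [k Ak]|w [k _ [_ ?]]]; last by exists k.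
  have ex : exists k, 2 * lam <= `|D (t k) w| by exists k.
  case: (ex_minnP ex) => m Am minm; exists m => //; split=> // u.
  move=> /mapP[i]; rewrite mem_iota add0n => /andP[_ im] ->.
  by rewrite ltNge; apply/negP => /minm; rewrite leqNgt im.
have tE : trivIset setT E.
  suff lt i j w : (i < j)%N -> E i w -> E j w -> False.
    move=> i j _ _ [w [Ei Ej]].
    by case: (ltngtP i j) => // ij; exfalso; [exact: lt ij Ei Ej|exact: lt ij Ej Ei].
  move=> ij [_ /= Ei] [/= Ej _]; move: Ei; apply/negP; rewrite -ltNge; apply: Ej.
  by apply: map_f; rewrite mem_iota add0n.
have tEF : trivIset setT (fun k => E k `&` F).
  by move=> i j _ _ [w [[Ei _] [Ej _]]]; apply: tE => //; exists w.
rewrite EU measure_semi_bigcup//; last exact: bigcupT_measurable.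
apply: (@le_trans _ _ (\sum_(k <oo) 2%:E * P (E k `&` F))%E).
  by apply: lee_nneseries => // k _; exact: first_passage_le.
rewrite nneseriesZl// -measure_semi_bigcup//; last 2 first.
- by move=> k; exact: measurableI.
- by apply: bigcupT_measurable => k; exact: measurableI.
rewrite EFinM; apply: lee_wpmul2l => //.
apply: (@le_trans _ _ (P F)).
  apply: le_measure; rewrite ?inE//.
    by apply: bigcupT_measurable => k; exact: measurableI.
  by move=> w [k _ []].
apply: le_trans (chain_law_le mS code_inj hX
  [set y | (lam <= `|g y - g x0 - delta * n%:R|)%R] (ler0n R n)) _.
by apply: chebyshev => //; rewrite ler0n lexx.
Qed.

(** Grid times are capped at [n], so [k] ranges over all naturals and each grid is a sequence fit
    for [ottaviani]. *)
Definition dyadic_exceedance (n : nat) (lam : R) : set T :=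
  \bigcup_j [set w | exists k : nat,
    2 * lam <= `|D (Num.min n%:R (k%:R / 2 ^+ j)) w|].

Let dyadic_ge0 (n k j : nat) : 0 <= Num.min n%:R (k%:R / 2 ^+ j) :> R.
Proof. by rewrite le_min ler0n divr_ge0// exprn_ge0. Qed.

Let measurable_dyadic (n j : nat) (lam : R) : measurable [set w | exists k : nat,
    2 * lam <= `|D (Num.min n%:R (k%:R / 2 ^+ j)) w|].
Proof.
rewrite (_ : [set _ | _] = \bigcup_k [set w |
    2 * lam <= `|D (Num.min n%:R (k%:R / 2 ^+ j)) w|]).
  by apply: bigcupT_measurable => k; exact: measurable_level.
by apply/seteqP; split=> [w [k ?]|w [k _ ?]]; exists k.
Qed.

Lemma measurable_dyadic_exceedance n lam : measurable (dyadic_exceedance n lam).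
Proof. by apply: bigcupT_measurable => j; exact: measurable_dyadic. Qed.

(** The bound of [ottaviani] does not depend on the mesh, and the grids are nested, so continuity
    from below applies. *)
Lemma dyadic_exceedance_le (n : nat) (lam : R) : (0 < n)%N -> 0 < lam ->
  (P (dyadic_exceedance n lam) <= (2 * (v * n%:R / lam ^+ 2))%:E)%E.
Proof.
move=> n0 lam0.
set A := fun j => [set w | exists k : nat,
    2 * lam <= `|D (Num.min n%:R (k%:R / 2 ^+ j)) w|].
have cv : P (A j) @[j --> \oo] --> P (\bigcup_j A j).
  apply: nondecreasing_cvg_mu.
  - by move=> j; exact: measurable_dyadic.
  - exact: measurable_dyadic_exceedance.
  apply/nondecreasing_seqP => j; apply/subsetPset => w [k Ak].
  exists (2 * k)%N.
  have -> : (2 * k)%:R / 2 ^+ j.+1 = k%:R / 2 ^+ j :> R.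
    by rewrite natrM exprS; field; rewrite gt_eqF// exprn_gt0.
  exact: Ak.
rewrite /dyadic_exceedance -/A -(cvg_lim _ cv)//.
apply: lime_le; first by apply/cvg_ex; eexists; exact: cv.
apply: nearW => j; apply: ottaviani => //.
- move=> k l kl; rewrite le_min !ge_min lexx/= ler_pM2r ?invr_gt0 ?exprn_gt0//.
  by rewrite ler_nat kl orbT.
- by move=> k; rewrite dyadic_ge0 ge_min lexx.
Qed.

(** Over the horizon 2^n the level e 2^n is exceeded with probability O(2^-n); Borel-Cantelli
    applies. *)
Lemma eventually_small (e : R) : 0 < e ->
  {ae P, forall w, exists n0, forall n, (n0 <= n)%N ->
    ~ dyadic_exceedance (2 ^ n) (e * 2 ^+ n) w}.
Proof.
move=> e0; pose F n := dyadic_exceedance (2 ^ n) (e * 2 ^+ n).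
have mF n : measurable (F n) by exact: measurable_dyadic_exceedance.
(* Written with [2 ^ n.+1], hence the 4, to match the geometric series of [epsilon_trick0]; the
   absolute value of [v] makes the constant nonnegative. *)
have F_le n : (P (F n) <= (4 * `|v| / e ^+ 2 / (2 ^ n.+1)%:R)%:E)%E.
  have lam0 : 0 < e * 2 ^+ n by rewrite mulr_gt0 ?exprn_gt0.
  apply: le_trans (dyadic_exceedance_le _ lam0) _; first by rewrite expn_gt0.
  rewrite lee_fin !natrX [2 ^+ n.+1]exprS.
  rewrite (_ : 2 * _ = 4 * v / e ^+ 2 / (2 * 2 ^+ n)); last first.
    by field; rewrite !gt_eqF ?exprn_gt0.
  apply: ler_wpM2r; first by rewrite invr_ge0 mulr_ge0// exprn_ge0.
  apply: ler_wpM2r; first by rewrite invr_ge0 sqr_ge0.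
  by apply: ler_wpM2l => //; exact: ler_norm.
have sumF : (\sum_(n <oo) P (F n) < +oo)%E.
  apply: (@le_lt_trans _ _ (4 * `|v| / e ^+ 2)%:E); last exact: ltry.
  apply: (@le_trans _ _
    (\sum_(0 <= i <oo) (4 * `|v| / e ^+ 2 / (2 ^ i.+1)%:R)%:E)%E).
    by apply: lee_nneseries.
  apply: epsilon_trick0.
  by rewrite divr_ge0 ?sqr_ge0 ?mulr_ge0.
have null := lim_sup_set_cvg0 mF sumF.
exists (lim_sup_set F); split=> //.
  by apply: bigcap_measurable => // n _; exact: bigcup_measurable.
move=> w /= nw n _; apply: contrapT => nF; apply: nw; exists n => m nm Fm.
by apply: nF; exists m.
Qed.

End MaximalInequality.

(** * From dyadic times to all times *)

Section DyadicPaths.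
Context {R : realType} (D : R -> R).
Hypothesis D_right_continuous : forall t e : R, 0 <= t -> 0 < e ->
  \forall s \near t^'+, `|D s - D t| < e.

Lemma dyadic_between (t eta : R) : 0 <= t -> 0 < eta ->
  exists j k : nat, t < k%:R / 2 ^+ j < t + eta.
Proof.
(* [k] gives the first grid point strictly after [t]; the mesh is below [eta] because 1/eta < j + 1
   <= 2^j. *)
move=> t0 eta0; pose j := Num.truncn eta^-1; pose k := (Num.truncn (t * 2 ^+ j)).+1.
have p0 : 0 < 2 ^+ j :> R by rewrite exprn_gt0.
have jeta : (2 ^+ j)^-1 < eta.
  rewrite invf_plt ?posrE//; apply: lt_le_trans (truncnS_gt _) _.
  by rewrite -natrX ler_nat ltn_expl.
have kt : k%:R <= t * 2 ^+ j + 1.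
  by rewrite /k -natr1 lerD2r truncn_le mulr_ge0// ltW.
exists j, k; rewrite ltr_pdivlMr// truncnS_gt/= ltr_pdivrMr//.
apply: le_lt_trans kt _; rewrite mulrDl ltrD2l.
by rewrite -ltr_pdivrMr// mul1r.
Qed.

(** [t] is approximated by dyadic times from the right, which stay below [M] because [t < M%:R]; the
    limit turns the strict bound into a weak one. *)
Lemma dyadic_bound (M : nat) (B t : R) :
  (forall j k : nat, `|D (Num.min M%:R (k%:R / 2 ^+ j))| < B) ->
  0 <= t < M%:R -> `|D t| <= B.
Proof.
move=> DB /andP[t0 tM]; apply/ler_addgt0Pr => e e0.
have /nbhs_ballP[eta /= eta0 He] := D_right_continuous t0 e0.
have [|j [k /andP[tk ke]]] := @dyadic_between t (Num.min eta (M%:R - t)) t0.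
  by rewrite lt_min eta0 subr_gt0.
have kM : k%:R / 2 ^+ j < M%:R :> R.
  by apply: (lt_le_trans ke); rewrite -lerBrDl ge_min lexx orbT.
have keta : k%:R / 2 ^+ j - t < eta.
  by rewrite ltrBlDl; apply: (lt_le_trans ke); rewrite lerD2l ge_min lexx.
have := DB j k; rewrite (min_idPr (ltW kM)) => Dk.
have := He (k%:R / 2 ^+ j); rewrite /ball/= => /(_ _ tk).
rewrite distrC gtr0_norm ?subr_gt0// => /(_ keta) De.
rewrite (_ : D t = D (k%:R / 2 ^+ j) - (D (k%:R / 2 ^+ j) - D t)); last by ring.
by rewrite (le_trans (ler_normB _ _))// lerD// ltW.
Qed.

(** For 2^n <= t < 2^(n+1) the bound on the horizon 2^(n+1), divided by t, is at most 4 / (i + 1);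
    [i] is chosen to make this at most [e]. *)
Lemma dyadic_sublinear :
  (forall i : nat, exists n0, forall n, (n0 <= n)%N -> forall j k : nat,
    `|D (Num.min (2 ^ n)%:R (k%:R / 2 ^+ j))| < 2 * (i.+1%:R^-1 * 2 ^+ n)) ->
  t^-1 * D t @[t --> +oo] --> 0.
Proof.
move=> small; apply/cvgr0Pnorm_le => e e0.
pose i := Num.truncn (4 / e).
have ie : 4 * i.+1%:R^-1 <= e.
  by rewrite ler_pdivrMr// mulrC -ler_pdivrMr// ltW// truncnS_gt.
have [n0 Hn0] := small i.
near=> t.
have t1 : 1 <= t by near: t; exact: nbhs_pinfty_ge.
have tn0 : (2 ^ n0)%:R <= t by near: t; exact: nbhs_pinfty_ge.
have tpos : 0 < t by exact: lt_le_trans t1.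
pose N := Num.truncn t.
have N0 : (0 < N)%N by rewrite truncn_gt0.
have /andP[Nlo Nhi] := trunc_log_bounds (isT : (1 < 2)%N) N0.
set n := trunc_log 2 N in Nlo Nhi.
have nt : (2 ^ n)%:R <= t.
  by apply: (@le_trans _ _ N%:R); rewrite ?ler_nat// truncn_le ltW.
have tn : t < (2 ^ n.+1)%:R.
  by apply: (lt_le_trans (truncnS_gt t)); rewrite ler_nat.
have n0n : (n0 <= n.+1)%N.
  rewrite -(leq_exp2l (m := 2))// -(ler_nat R).
  exact: le_trans tn0 (ltW tn).
have Dt : `|D t| <= 2 * (i.+1%:R^-1 * 2 ^+ n.+1).
  apply: (@dyadic_bound (2 ^ n.+1)); first exact: Hn0.
  by rewrite tn (ltW tpos).
rewrite normrM gtr0_norm ?invr_gt0// mulrC ler_pdivrMr//.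
apply: le_trans Dt _.
rewrite (_ : 2 * _ = 4 * i.+1%:R^-1 * 2 ^+ n); last by rewrite exprS; ring.
by apply: ler_pM => //; rewrite ?mulr_ge0 ?invr_ge0 ?exprn_ge0// -natrX.
Unshelve. all: by end_near. Qed.

End DyadicPaths.

Lemma linear_growth_of_centred {R : realType} (G : R -> R) (c delta : R) :
  t^-1 * (G t - c - delta * t) @[t --> +oo] --> 0 ->
  t^-1 * G t @[t --> +oo] --> delta.
Proof.
move=> D0.
have inv0 : t^-1 @[t --> +oo] --> (0 : R).
  apply: (gtr0_cvgV0 (f := id) _).2; last exact: cvg_id.
  exact: nbhs_pinfty_gt.
have : t^-1 * (G t - c - delta * t) + t^-1 * c + delta @[t --> +oo] --> 0 + 0 * c + delta.
  by apply: cvgD; [apply: cvgD => //; apply: cvgMl|exact: cvg_cst].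
rewrite mul0r !add0r; apply: cvg_trans; apply: near_eq_cvg; near=> t.
have t0 : t != 0 by rewrite gt_eqF//; near: t; exact: nbhs_pinfty_gt.
by field.
Unshelve. all: by end_near. Qed.

(** The nonnegative case is applied to the positive and negative parts; integrability under [p h x]
    makes the difference meaningful. *)
Lemma integral_chain_step {R : realType} {d} {S : measurableType d}
    (mS : forall A : set S, measurable A) (code : S -> nat) (code_inj : injective code)
    {d'} {T : measurableType d'} (P : probability T R)
    (p : R -> R.-pker S ~> S) (x0 : S) (X : R -> T -> S)
    (hX : is_markov_chain P p x0 X) (t h : R) (x : S) (f : S -> \bar R) :
  0 <= t -> 0 <= h -> (p h x).-integrable [set: S] f ->
  (\int[P]_(w in [set w | X t w = x]) f (X (t + h)%R w)
    = P [set w | X t w = x] * \int[p h x]_y f y)%E.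
Proof.
move=> t0 h0 fi; set A := [set w | X t w = x].
have fA : P A \is a fin_num.
  by apply: fin_num_measure; exact: (measurable_chain_event mS hX [set x] t0).
have step := ge0_integral_chain_step mS code_inj hX x t0 h0.
transitivity (P A * \int[p h x]_y f^\+ y - P A * \int[p h x]_y f^\- y)%E.
  rewrite -!step// [LHS]integralE.
  by congr (_ - _)%E; apply: eq_integral => w _; rewrite ?funeposE ?funenegE.
have fp := integrable_fin_num measurableT (integrable_funepos measurableT fi).
by rewrite -muleBr ?fin_num_adde_defr// -integralE.
Qed.

(** * Mean and linear growth of an observable with constant drift *)

Section ConstantDrift.
Context {R : realType} {d : measure_display} {S : measurableType d}.
Hypothesis mS : forall A : set S, measurable A.
Context (code : S -> nat) (code_inj : injective code).
Context (q : S -> S -> R) (p : R -> R.-pker S ~> S).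
Hypothesis hp : is_transition_function q p.
Context (I : finType) (r : I -> S -> R) (tau : I -> S -> S) (C : R).
Hypothesis r_ge0 : forall k x, 0 <= r k x.
Hypothesis r_le : forall x, \sum_k r k x <= C.
Hypothesis qE : forall x y,
  q x y = \sum_k r k x * ((y == tau k x)%:R - (y == x)%:R).
Context (g : S -> R) (delta : R).
Hypothesis g_jump : forall k x, `|g (tau k x) - g x| <= 1.
Hypothesis g_drift : forall x, generator r tau g x = delta.
Context {d' : measure_display} {T : measurableType d'} (P : probability T R).
Context (x0 : S) (X : R -> T -> S).
Hypothesis hX : is_markov_chain P p x0 X.

Lemma transition_mean (x : S) (h : R) : 0 <= h ->
  (\int[p h x]_y (g y - g x)%:E = (h * delta)%:E)%E.
Proof.
move=> h0; rewrite -(EFin_Rintegral mS); last first.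
  exact: (integrable_increment mS hp r_ge0 r_le qE g_jump).
by rewrite (Rintegral_increment mS hp r_ge0 r_le qE g_jump g_drift)// mulrC.
Qed.

Lemma cond_expectation_increment (t h : R) (x : S) : 0 <= t -> 0 <= h ->
  (0 < P [set w | X t w = x])%E ->
  cond_expectation P [set w | X t w = x] (fun w => g (X (t + h) w) - g (X t w))
    = (h * delta)%:E.
Proof.
move=> t0 h0; rewrite /cond_expectation; set A := [set w | X t w = x] => PA.
have fA : P A \is a fin_num.
  by apply: fin_num_measure; exact: (measurable_chain_event mS hX [set x] t0).
have -> : (\int[P]_(w in A) (g (X (t + h) w) - g (X t w))%:E
    = \int[P]_(w in A) (g (X (t + h) w) - g x)%:E)%E.
  by apply: eq_integral => w; rewrite inE => /= ->.
have gi := integrable_increment mS hp r_ge0 r_le qE g_jump x h0.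
rewrite (integral_chain_step mS code_inj hX t0 h0 gi) -/A transition_mean//.
rewrite -(fineK fA) -!EFinM mulrAC divff ?mul1r//.
by rewrite gt_eqF// fine_gt0// PA -ge0_fin_numE.
Qed.

Lemma ae_linear_growth :
  {ae P, forall w, t^-1 * g (X t w) @[t --> +oo] --> delta}.
Proof.
have cheb := chebyshev_transition mS hp r_ge0 r_le qE g_jump g_drift.
(* The levels 1/(i + 1) are countably many, so one null set serves them all. *)
have small : {ae P, forall w, forall i : nat, exists n0, forall n, (n0 <= n)%N ->
    ~ dyadic_exceedance x0 X g delta (2 ^ n) (i.+1%:R^-1 * 2 ^+ n) w}.
  apply: ae_foralln => i.
  by apply: (eventually_small mS code_inj hX cheb); rewrite invr_gt0.
apply: filterS2 small (chain_right_continuous hX) => w small rc.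
apply: (@linear_growth_of_centred _ _ (g x0)).
apply: (@dyadic_sublinear _ (fun t => g (X t w) - g x0 - delta * t)).
(* The chain is constant just after [t], so there the centred path moves only through its term
   [delta * t]. *)
- move=> t e t0 e0.
  have k0 : 0 < `|delta| + 1 by rewrite ltr_wpDl.
  have near_t : \forall s \near t^'+, s < t + e / (`|delta| + 1).
    by apply: nbhs_right_lt; rewrite ltrDl divr_gt0.
  apply: filterS3 (rc t t0) near_t (nbhs_right_gt t) => s -> st ts.
  rewrite (_ : _ - _ = - (delta * (s - t))); last by ring.
  have st0 : 0 < s - t by rewrite subr_gt0.
  rewrite normrN normrM (gtr0_norm st0).
  apply: (@le_lt_trans _ _ ((`|delta| + 1) * (s - t))).
    by rewrite ler_wpM2r ?lerDl// ltW.
  by rewrite mulrC -ltr_pdivlMr// ltrBlDl.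
- move=> i; have [n0 Hn0] := small i; exists n0 => n nn j k.
  rewrite ltNge; apply/negP => big; apply: (Hn0 n nn).
  by exists j => //; exists k.
Qed.

End ConstantDrift.

(** * The elastic particle system *)

Section ElasticMoves.
Context {R : realType} {N : nat} (m a b : 'I_N -> R).
Hypothesis hm : forall i, 0 < m i.
Hypothesis ha : forall i, 0 <= a i.
Hypothesis hb : forall i, 0 <= b i.

Lemma config_le (x : XN N) (i j : 'I_N) : (i <= j)%N -> val x i <= val x j.
Proof. by move=> ij; have /forallP/(_ i)/forallP/(_ j)/implyP/(_ ij) := valP x. Qed.

Lemma move_down_ordered (x : XN N) (i : 'I_N) :
  free_below x i -> ordered_config (move_down i x).
Proof.
move=> /forallP free; apply/forallP => j; apply/forallP => k; apply/implyP => jk.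
rewrite !ffunE; have xjk := config_le x jk.
have [ji|ji] := eqVneq j i; have [ki|ki] := eqVneq k i; rewrite /= ?subr0 ?lerD2r//.
  by rewrite (le_trans _ xjk)// gerBl.
have ji' : (j < i)%N by rewrite ltn_neqAle -[X in _ && X]/(j <= i)%N -ki jk andbT ki.
(* The only critical case is j < k = i: the neighbour below [i] is strictly lower, and [x j] is at
   most its position. *)
have pi : (i.-1 < N)%N by apply: leq_ltn_trans (leq_pred i) (ltn_ord i).
have := free (Ordinal pi); rewrite /= prednK ?(leq_ltn_trans _ ji')// eqxx /= => lt.
have jle : (j <= Ordinal pi)%N by rewrite /= -ltnS prednK// (leq_ltn_trans _ ji').
rewrite ki lerBrDr -lezD1 in lt *.
by apply: le_trans lt; rewrite lerD2r config_le.
Qed.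

Lemma move_up_ordered (x : XN N) (i : 'I_N) :
  free_above x i -> ordered_config (move_up i x).
Proof.
move=> /forallP free; apply/forallP => j; apply/forallP => k; apply/implyP => jk.
rewrite !ffunE; have xjk := config_le x jk.
have [ji|ji] := eqVneq j i; have [ki|ki] := eqVneq k i; rewrite /= ?addr0 ?lerD2r//.
  have ik : (i < k)%N by rewrite ltn_neqAle -[X in _ && X]/(i <= k)%N -ji jk andbT ji eq_sym.
  have si : (i.+1 < N)%N by apply: leq_ltn_trans ik (ltn_ord k).
  have := free (Ordinal si); rewrite /= eqxx /= => lt.
  rewrite ji lezD1; apply: lt_le_trans lt _; exact: config_le.
by rewrite (le_trans xjk)// lerDl.
Qed.

(* A move leaving [XN N] is replaced by staying put; its rate is 0. *)
Definition elastic_target (k : 'I_N + 'I_N) (x : XN N) : XN N :=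
  match k with
  | inl i => insubd x (move_down i x)
  | inr i => insubd x (move_up i x)
  end.

Definition elastic_rate (k : 'I_N + 'I_N) (x : XN N) : R :=
  match k with
  | inl i => rate_down m a i x
  | inr i => rate_up m b i x
  end.

(** A crude bound uniform in the configuration: every indicator is replaced by 1. *)
Definition elastic_rate_bound : R :=
  \sum_(i < N) \sum_(j < N) m j * a j / m i + \sum_(i < N) \sum_(j < N) m j * b j / m i.

Let weight_ge0 (c : 'I_N -> R) i j : (forall i, 0 <= c i) -> 0 <= m j * c j / m i.
Proof. by move=> c0; rewrite divr_ge0 ?mulr_ge0 ?(ltW (hm _)). Qed.

Lemma elastic_rate_ge0 k x : 0 <= elastic_rate k x.
Proof.
by case: k => i; rewrite mulr_ge0 ?ler0n// sumr_ge0// => j _;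
  rewrite mulr_ge0 ?weight_ge0 ?ler0n.
Qed.

Let partial_sum_le (c : 'I_N -> R) (x : XN N) (i : 'I_N) (A : pred 'I_N) (f : bool) :
  (forall i, 0 <= c i) ->
  f%:R * (\sum_(j < N | A j) m j * c j / m i * (val x j == val x i)%:R)
    <= \sum_(j < N) m j * c j / m i.
Proof.
move=> c0; apply: (@le_trans _ _ (\sum_(j < N | A j) m j * c j / m i)).
  apply: le_trans (_ : \sum_(j < N | A j) m j * c j / m i * (val x j == val x i)%:R <= _).
    apply: ler_piMl; last by case: f.
    by apply: sumr_ge0 => j _; rewrite mulr_ge0 ?weight_ge0 ?ler0n.
  apply: ler_sum => j _; apply: ler_piMr; first exact: weight_ge0.
  by case: (_ == _).
rewrite [leRHS](bigID A)/= lerDl sumr_ge0// => j _; exact: weight_ge0.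
Qed.

Lemma sum_elastic_rate_le x : \sum_k elastic_rate k x <= elastic_rate_bound.
Proof.
rewrite big_sumType/=; apply: lerD; apply: ler_sum => i _; exact: partial_sum_le.
Qed.

Lemma elastic_rateP (k : 'I_N + 'I_N) (x : XN N) :
  elastic_rate k x = 0 \/
  val (elastic_target k x) =
    match k with inl i => move_down i x | inr i => move_up i x end.
Proof.
case: k => i /=; rewrite /rate_down /rate_up.
- have [free|nfree] := boolP (free_below x i); last by left; rewrite mul0r.
  by right; rewrite val_insubd move_down_ordered.
- have [free|nfree] := boolP (free_above x i); last by left; rewrite mul0r.
  by right; rewrite val_insubd move_up_ordered.
Qed.

(** Off the diagonal the sums agree term by term. On it a genuine move never fixes [x], and a move
    replaced by staying put has rate 0. *)
Lemma elastic_QE (x y : XN N) : elastic_Q m a b x y =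
  \sum_k elastic_rate k x * ((y == elastic_target k x)%:R - (y == x)%:R).
Proof.
rewrite big_sumType/= -big_split/= /elastic_Q.
have mv (i : 'I_N) : (move_down i x != val x) /\ (move_up i x != val x).
  by split; apply/eqP => /ffunP/(_ i)/eqP; rewrite ffunE eqxx
    -[X in _ == X]addr0 (inj_eq (addrI _)).
have [<-|xy] := eqVneq x y.
  rewrite -sumrN; apply: eq_bigr => i _.
  have [mdn mun] := mv i.
  have stay k : elastic_rate k x * (x == elastic_target k x)%:R = 0.
    case: (elastic_rateP k x) => [->|e]; first by rewrite mul0r.
    rewrite -val_eqE e; case: k {e} => j; have [h1 h2] := mv j.
      by rewrite eq_sym (negPf h1) mulr0.
    by rewrite eq_sym (negPf h2) mulr0.
  rewrite !mulrBr (stay (inl i)) (stay (inr i)) !mulr1 !sub0r -opprD.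
  by [].
apply: eq_bigr => i _; rewrite !subr0.
have eqmove (k : 'I_N + 'I_N) (z : {ffun 'I_N -> int}) :
    elastic_rate k x = 0 \/ val (elastic_target k x) = z ->
    elastic_rate k x * (y == elastic_target k x)%:R
      = elastic_rate k x * (val y == z)%:R.
  by case=> [->|<-]; rewrite ?mul0r ?val_eqE.
rewrite (eqmove (inl i) _ (elastic_rateP (inl i) x)).
by rewrite (eqmove (inr i) _ (elastic_rateP (inr i) x)).
Qed.

Lemma total_mass_gt0 : (0 < N)%N -> 0 < total_mass m.
Proof.
move=> N0; rewrite /total_mass (bigD1 (Ordinal N0))//= ltr_pwDl//.
by rewrite sumr_ge0// => i _; exact: ltW.
Qed.

Lemma centre_of_mass_move (z : int) (x y : XN N) (i : 'I_N) :
  (forall j, val y j = val x j + (j == i)%:Z * z) ->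
  centre_of_mass m y - centre_of_mass m x = m i / total_mass m * z%:~R.
Proof.
move=> yE; rewrite /centre_of_mass -mulrBr -sumrB (bigD1 i)//= big1 ?addr0.
  rewrite yE eqxx mul1r rmorphD/= -mulrBr addrC addKr.
  by rewrite mulrCA mulrA.
by move=> j /negPf ji; rewrite yE ji mul0r addr0 subrr.
Qed.

End ElasticMoves.

(** * Jumps and drift of the centre of mass *)

Section ElasticDrift.
Context {R : realType} {N : nat} (m a b : 'I_N -> R).
Hypothesis hm : forall i, 0 < m i.

(* In every cluster exactly one particle, the topmost, is free to move up. *)
Lemma sum_free_above (x : XN N) (j : 'I_N) :
  \sum_(i < N | (j <= i)%N)
    (free_above x i)%:R * (val x j == val x i)%:R = 1 :> R.
Proof.
have := @arg_maxnP _ j (fun i => val x i == val x j) (fun i : 'I_N => i : nat) (eqxx _).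
move=> [i0 /eqP xi0 max]; have ji0 : (j <= i0)%N by apply: max.
rewrite (bigD1 i0)//= xi0 eqxx mulr1 big1 ?addr0.
  rewrite (_ : free_above x i0)//; apply/forallP => k; apply/implyP => /eqP ik.
  rewrite lt_neqAle config_le ?andbT -?ik//; apply/negP => /eqP xk.
  have := max k; rewrite -xk xi0 eqxx => /(_ isT).
  by rewrite /= -ik ltnn.
move=> i /andP[ji ii0]; have [xji|] := eqVneq (val x j) (val x i); last by rewrite mulr0.
have ile : (i <= i0)%N by apply: max; rewrite -xji.
have ilt : (i < i0)%N by rewrite ltn_neqAle ii0.
(* Below the top of the cluster the next particle has the same position and blocks the move. *)
have si : (i.+1 < N)%N by exact: leq_ltn_trans ilt (ltn_ord i0).
rewrite (_ : free_above x i = false) ?mul0r//.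
apply/negP => /forallP/(_ (Ordinal si)); rewrite /= eqxx /= ltNge.
by rewrite -xji -xi0 config_le.
Qed.

(** Mirror image of [sum_free_above], with the lowest particle of the cluster. *)
Lemma sum_free_below (x : XN N) (j : 'I_N) :
  \sum_(i < N | (i <= j)%N)
    (free_below x i)%:R * (val x j == val x i)%:R = 1 :> R.
Proof.
have := @arg_minnP _ j (fun i => val x i == val x j) (fun i : 'I_N => i : nat) (eqxx _).
move=> [i0 /eqP xi0 min]; have ji0 : (i0 <= j)%N by apply: min.
rewrite (bigD1 i0)//= xi0 eqxx mulr1 big1 ?addr0.
  rewrite (_ : free_below x i0)//; apply/forallP => k; apply/implyP => /eqP ik.
  rewrite lt_neqAle config_le ?andbT -?ik//; apply/negP => /eqP xk.
  have := min k; rewrite xk xi0 eqxx => /(_ isT).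
  by rewrite /= -ik ltnn.
move=> i /andP[ji ii0]; have [xji|] := eqVneq (val x j) (val x i); last by rewrite mulr0.
have ile : (i0 <= i)%N by apply: min; rewrite -xji.
have ilt : (i0 < i)%N by rewrite ltn_neqAle eq_sym ii0.
have ip : (0 < i)%N by exact: leq_ltn_trans ilt.
have pi : (i.-1 < N)%N by exact: leq_ltn_trans (leq_pred i) (ltn_ord i).
rewrite (_ : free_below x i = false) ?mul0r//.
apply/negP => /forallP/(_ (Ordinal pi)); rewrite /= prednK// eqxx /= ltNge.
by rewrite -xji -xi0 config_le//= -ltnS prednK.
Qed.

(** The mass [m i] cancels; after exchanging the sums, the coefficient of [m j * b j] is the sum in
    [sum_free_above]. *)
Lemma sum_mass_rate_up (x : XN N) :
  \sum_(i < N) m i * rate_up m b i x = \sum_(j < N) m j * b j.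
Proof.
have term i : m i * rate_up m b i x = \sum_(j < N | (j <= i)%N)
    m j * b j * ((free_above x i)%:R * (val x j == val x i)%:R).
  rewrite /rate_up mulrA mulr_sumr; apply: eq_bigr => j _.
  by field; rewrite gt_eqF.
under eq_bigr do rewrite term.
rewrite (exchange_big_dep xpredT)//=; apply: eq_bigr => j _.
by rewrite -mulr_sumr sum_free_above mulr1.
Qed.

Lemma sum_mass_rate_down (x : XN N) :
  \sum_(i < N) m i * rate_down m a i x = \sum_(j < N) m j * a j.
Proof.
have term i : m i * rate_down m a i x = \sum_(j < N | (i <= j)%N)
    m j * a j * ((free_below x i)%:R * (val x j == val x i)%:R).
  rewrite /rate_down mulrA mulr_sumr; apply: eq_bigr => j _.
  by field; rewrite gt_eqF.
under eq_bigr do rewrite term.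
rewrite (exchange_big_dep xpredT)//=; apply: eq_bigr => j _.
by rewrite -mulr_sumr sum_free_below mulr1.
Qed.

Let step (k : 'I_N + 'I_N) : int := if k is inl _ then -1 else 1.
Let mover (k : 'I_N + 'I_N) : 'I_N := match k with inl i => i | inr i => i end.

Let centre_of_mass_target (k : 'I_N + 'I_N) (x : XN N) :
  elastic_rate m a b k x = 0 \/
  centre_of_mass m (elastic_target k x) - centre_of_mass m x
    = m (mover k) / total_mass m * (step k)%:~R.
Proof.
case: (elastic_rateP m a b k x) => [|e]; [by left|right].
apply: centre_of_mass_move => j; rewrite e.
by case: k {e} => i; rewrite ffunE /= ?mulrN1 ?mulr1.
Qed.

(** A single mass is at most the total mass; a move that would leave [XN N] gives displacement 0. *)
Lemma centre_of_mass_jump (N0 : (0 < N)%N) (k : 'I_N + 'I_N) (x : XN N) :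
  `|centre_of_mass m (elastic_target k x) - centre_of_mass m x| <= 1.
Proof.
have M0 := total_mass_gt0 hm N0.
have mi i : `|m i / total_mass m| <= 1.
  rewrite ger0_norm ?divr_ge0 ?(ltW (hm _)) ?(ltW M0)// ler_pdivrMr// mul1r.
  by rewrite /total_mass (bigD1 i)//= lerDl sumr_ge0// => j _; exact: ltW.
have move_norm (s : int) (y : XN N) i : `|s| <= 1 ->
    (forall j, val y j = val x j + (j == i)%:Z * s) ->
    `|centre_of_mass m y - centre_of_mass m x| <= 1.
  move=> s1 yE; rewrite (centre_of_mass_move _ yE) normrM mulr_ile1//.
  by rewrite -intr_norm (ler_int R _ 1).
case: k => i /=.
- rewrite /insubd; case: insubP => [y _ yE|_] /=; last by rewrite subrr normr0.
  by apply: (move_norm (-1) _ i) => // j; rewrite yE ffunE mulrN1.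
- rewrite /insubd; case: insubP => [y _ yE|_] /=; last by rewrite subrr normr0.
  by apply: (move_norm 1 _ i) => // j; rewrite yE ffunE mulr1.
Qed.

Lemma centre_of_mass_drift (x : XN N) :
  generator (elastic_rate m a b) (@elastic_target N) (centre_of_mass m) x
    = - U_N m a b / total_mass m.
Proof.
rewrite /generator.
have term k : elastic_rate m a b k x *
    (centre_of_mass m (elastic_target k x) - centre_of_mass m x)
    = m (mover k) * elastic_rate m a b k x * (step k)%:~R / total_mass m.
  case: (centre_of_mass_target k x) => [->|->]; first by rewrite mulr0 !mul0r.
  by ring.
under eq_bigr do rewrite term.
rewrite -mulr_suml big_sumType/=; congr (_ / _).
rewrite /U_N opprK.
under eq_bigr do rewrite mulrN1; under [X in _ + X]eq_bigr do rewrite mulr1.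
rewrite sumrN sum_mass_rate_down sum_mass_rate_up addrC -sumrB.
by apply: eq_bigr => i _; rewrite mulrBr.
Qed.

End ElasticDrift.

(* The expectation of G(t+h) - G(t) given X(t) = x is taken under the transition
   law p_h(x,.) for every state x, and it is moreover the elementary conditional
   expectation whenever the event X(t) = x has positive probability. *)
Theorem theorem3p1 (R : realType) (N : nat) (hN : (0 < N)%N)
    (m a b : 'I_N -> R)
    (hm : forall i, 0 < m i) (ha : forall i, 0 <= a i) (hb : forall i, 0 <= b i)
    (d : measure_display) (T : measurableType d) (P : probability T R)
    (p : R -> R.-pker (XN N) ~> (XN N))
    (hp : is_transition_function (elastic_Q m a b) p)
    (x0 : XN N) (X : R -> T -> XN N) (hX : is_markov_chain P p x0 X) :
  let G := fun t w => centre_of_mass m (X t w) in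
  let drift := - U_N m a b / total_mass m in
  (forall (t h : R) (x : XN N), 0 <= t -> 0 <= h ->
     (\int[p h x]_y (centre_of_mass m y - centre_of_mass m x)%:E
        = (h * drift)%:E)%E
     /\ ((0 < P [set w | X t w = x])%E ->
         cond_expectation P [set w | X t w = x] (fun w => G (t + h) w - G t w)
           = (h * drift)%:E))
  /\ {ae P, forall w, t^-1 * G t w @[t --> +oo] --> drift}.
Proof.
move=> G drift.
(* The state space carries the discrete sigma-algebra and is countable, with [pickle] as the
   injective code. *)
have mS (A : set (XN N)) : measurable A by [].
have code_inj : injective (pickle : XN N -> nat) := pcan_inj pickleK.
have r_ge0 := elastic_rate_ge0 hm ha hb.
have r_le := sum_elastic_rate_le hm ha hb.
have qE := elastic_QE m a b.
have g_jump := centre_of_mass_jump hm hN.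
have g_drift := centre_of_mass_drift a b hm.
split=> [t h x t0 h0|].
  split; first exact: (transition_mean mS hp r_ge0 r_le qE g_jump g_drift).
  exact: (cond_expectation_increment mS code_inj hp r_ge0 r_le qE g_jump g_drift hX).
exact: (ae_linear_growth mS code_inj hp r_ge0 r_le qE g_jump g_drift hX).
Qed.
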